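(* Consider the finite-template model (mean-shift or variance-shift, described in the context) in the smooth-signal regime under the standard consecutive placement family $\mathcal{K}^{\mathsf{con}}_{k,m,n}$, and let $\mathcal{E}=\max_{\ell\in[m]}\sum_{u\in[k]\times[k]}\vartheta_{\ell,u}^2$, where $\vartheta_\ell=M_\ell$ in the mean-shift model and $\vartheta_\ell=\Sigma_\ell$ in the variance-shift model. If $$\mathcal{E}=o\left(\log\left(1+\frac{n^2}{k^2m^2}\right)\right)\qquad\text{and}\qquad mk=o(n),$$ then $d_{\mathsf{TV}}(\mathbb{P}_{\mathcal{H}_0},\mathbb{P}_{\mathcal{H}_1})=o(1)$.
   Context: **Asymptotics.** All asymptotic statements are as $n\to\infty$; $m=m(n)$, $k=k(n)$ are positive integers with $mk\le n$, and the templates may depend on $n$. $[k]=\{1,\dots,k\}$; $\|M\|_\infty=\max_{i,j}|M_{ij}|$; $d_{\mathsf{TV}}(\mathbb{P},\mathbb{Q})=\frac12\int|\mathrm{d}\mathbb{P}-\mathrm{d}\mathbb{Q}|$. **Blocks and placements.** $\mathcal{B}^{\mathsf{con}}_{k,n}$ is the set of $S\times T$ with $S,T\in\{\{i+1,\dots,i+k\}:i=0,\dots,n-k\}$. The standard consecutive placement family $\mathcal{K}^{\mathsf{con}}_{k,m,n}$ is the set of all unordered collections of $m$ pairwise disjoint blocks from $\mathcal{B}^{\mathsf{con}}_{k,n}$. For a block $B=S\times T$ with $S=\{s_1<\dots<s_k\}$, $T=\{t_1<\dots<t_k\}$, the coordinate map $\varphi_B:B\to[k]\times[k]$ is $\varphi_B(s_u,t_v)=(u,v)$.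 **Models.** One observes $X\in\mathbb{R}^{n\times n}$. Under $\mathcal{H}_0$ the entries are i.i.d. $\mathcal{N}(0,1)$ (law $\mathbb{P}_{\mathcal{H}_0}$). Under $\mathcal{H}_1$, $K$ is drawn uniformly from the placement family, then, conditional on $K$, a bijection $\beta:K\to[m]$ is drawn uniformly; given $(K,\beta)$ the entries of $X$ are independent with $X_{ij}\sim\mathcal{P}_{\beta(B),\varphi_B(i,j)}$ if $(i,j)\in B$ for some $B\in K$, and $X_{ij}\sim\mathcal{N}(0,1)$ otherwise. $\mathbb{P}_{\mathcal{H}_1}$ is the marginal (mixture) law of $X$. Mean-shift model: $\mathcal{P}_{\ell,u}=\mathcal{N}((M_\ell)_u,1)$ with $M_\ell\in\mathbb{R}^{k\times k}$, $\ell\in[m]$. Variance-shift model: $\mathcal{P}_{\ell,u}=\mathcal{N}(0,1+(\Sigma_\ell)_u)$ with $0\le(\Sigma_\ell)_u\le\vartheta_0$ for a fixed $\vartheta_0\in[0,1)$ independent of $n$. **Smooth-signal regime.** With $\mathcal{E}_\ell=\sum_{u\in[k]\times[k]}\vartheta_{\ell,u}^2$, the model operates in the smooth-signal regime if $\sup_{\ell\in[m]}\|\vartheta_\ell\|_\infty=O(1)$ (uniform boundedness) and $\sup_{\ell\in[m]}\frac{k^2\|\vartheta_\ell\|_\infty^2}{\mathcal{E}_\ell}=O(1)$ (non-spikiness). *)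

(* Defs.v *)
From HB Require Import structures.
From mathcomp Require Import all_boot all_order all_algebra.
From mathcomp Require Import all_classical all_reals all_analysis zify.

Set Implicit Arguments.
Unset Strict Implicit.
Unset Printing Implicit Defensive.

Import Order.TTheory GRing.Theory Num.Theory.
Import numFieldNormedType.Exports.

Local Open Scope classical_set_scope.
Local Open Scope ring_scope.

Section product_probability.
Context d (T : measurableType d) (R : realType).

Definition cons_pair n (p : T * n.-tuple T) : n.+1.-tuple T :=
  [tuple of p.1 :: p.2].

Lemma measurable_cons_pair n : measurable_fun setT (@cons_pair n).
Proof. exact: (measurable_cons measurable_fst measurable_snd). Qed.

HB.instance Definition _ n :=
  isMeasurableFun.Build _ _ _ _ (@cons_pair n) (@measurable_cons_pair n).

(* The product of the laws [P i], on the product sigma-algebra of [T ^ n]. *)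
Fixpoint prod_prob n : ('I_n -> probability T R) -> probability (n.-tuple T) R :=
  match n with
  | 0 => fun=> \d_[tuple]
  | n'.+1 => fun P => distribution
      (P ord0 \x prod_prob (fun i => P (lift ord0 i)))%E (@cons_pair n')
  end.

Lemma prod_prob_box n (P : 'I_n -> probability T R) (A : 'I_n -> set T) :
  (forall i, measurable (A i)) ->
  prod_prob P [set x | forall i, A i (tnth x i)] = (\prod_(i < n) P i (A i))%E.
Proof.
elim: n P A => [|n IHn] P A mA.
  rewrite big_ord0 /= diracE mem_set//= => i; by case: i.
rewrite big_ord_recl /= /distribution /pushforward.
have mB : measurable
    [set x : n.-tuple T | forall i, A (lift ord0 i) (tnth x i)].
  rewrite (_ : mkset _ = \bigcap_(i in [set: 'I_n])
      ((@tnth n T)^~ i @^-1` A (lift ord0 i))); last first.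
    by apply/seteqP; split => [x Ax i _|x Ax i]; [exact: Ax|exact: Ax].
  apply: fin_bigcap_measurable => // i _; rewrite -[X in measurable X]setTI.
  exact: measurable_tnth.
rewrite -IHn// -product_measure1E//; congr (_ _).
apply/seteqP; split => -[a x] /=.
  move=> Ax; split; first by have := Ax ord0; rewrite tnth0.
  by move=> i; have := Ax (lift ord0 i); rewrite tnthS.
move=> [Aa Ax] i; case: (unliftP ord0 i) => [j|] ->.
  by rewrite tnthS; exact: Ax.
by rewrite tnth0.
Qed.

End product_probability.

Section uniform_mixture.
Context d (T : measurableType d) (R : realType) (I : finType) (D : {set I}).
Variable mu : I -> {finite_measure set T -> \bar R}.

(* The law of a sample from [mu i] for [i] uniform in [D]; null if [D] is empty. *)
Definition uniform_mixture (A : set T) : \bar R :=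
  ((#|D|%:R^-1 : R)%:E * \sum_(i in D) mu i A)%E.

Let mixture0 : uniform_mixture set0 = 0%E.
Proof.
by rewrite /uniform_mixture big1 ?mule0// => i _; rewrite measure0.
Qed.

Let mixture_ge0 A : (0 <= uniform_mixture A)%E.
Proof.
by rewrite mule_ge0 ?lee_fin ?invr_ge0 ?ler0n// sume_ge0// => i _.
Qed.

Let mixture_sigma_additive : semi_sigma_additive uniform_mixture.
Proof.
move=> F mF tF mUF; rewrite /uniform_mixture.
under eq_fun => n.
  rewrite -ge0_sume_distrr; last by move=> j _; exact: sume_ge0.
  rewrite exchange_big/=.
  over.
apply: cvgeZl => //; apply: cvg_nnesum => i _.
  by apply: nearW => n; exact: sume_ge0.
exact: measure_semi_sigma_additive.
Qed.

HB.instance Definition _ := isMeasure.Build _ _ _ uniform_mixture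
  mixture0 mixture_ge0 mixture_sigma_additive.

Let mixture_finite : fin_num_fun uniform_mixture.
Proof.
move=> A mA; rewrite /uniform_mixture fin_numM// sum_fin_num.
by apply/allP => _ /mapP[i _ ->]; exact: fin_num_measure.
Qed.

HB.instance Definition _ :=
  Measure_isFinite.Build _ _ _ uniform_mixture mixture_finite.

End uniform_mixture.

Lemma uniform_mixture_setT d (T : measurableType d) (R : realType) (I : finType)
    (D : {set I}) (mu : I -> {finite_measure set T -> \bar R}) :
  (0 < #|D|)%N -> (forall i, i \in D -> mu i setT = 1%E) ->
  uniform_mixture D mu setT = 1%E.
Proof.
move=> D0 mu1; rewrite /uniform_mixture (eq_bigr (fun=> 1%E))//.
by rewrite sumEFin -EFinM sumr_const mulVf// pnatr_eq0 -lt0n.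
Qed.

Section total_variation.
Context d (T : measurableType d) (R : realType).
Variables P Q : {finite_measure set T -> \bar R}.

Definition diff_charge : {charge set T -> \bar R} :=
  cadd (charge_of_finite_measure P) (copp (charge_of_finite_measure Q)).

(* [charge_variation] is the measure [|P - Q|]; it does not depend on the
   chosen Hahn decomposition. *)
Definition tv_dist : R :=
  let (Pos, exN) := cid (Hahn_decomposition diff_charge) in
  let (Neg, hahn) := cid exN in
  2^-1 * fine (charge_variation hahn setT).

End total_variation.

Notation cell n := ('I_n * 'I_n)%type.

(* The maps [beta : K -> [m]], defined on the blocks of [K] only. *)
Notation labelling m K := {ffun {B | B \in K} -> 'I_m}.

Section placements.
Local Open Scope set_scope.
Variables k m n : nat.

(* Indices are counted from 0. *)
Definition interval (i : nat) : {set 'I_n} := [set s : 'I_n | (i <= s < i + k)%N].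

Definition intervals : {set {set 'I_n}} :=
  [set interval i | i : 'I_n.+1 & (i + k <= n)%N].

Definition con_blocks : {set {set cell n}} :=
  [set finset.setX S S' | S in intervals, S' in intervals].

Definition con_placements : {set {set {set cell n}}} :=
  [set K : {set {set cell n}} |
    [&& K \subset con_blocks, #|K| == m & finset.trivIset K]].

Definition bijections (K : {set {set cell n}}) : {set labelling m K} :=
  [set b : labelling m K | injectiveb b && [forall l, l \in codom b]].

Definition rank_in (S : {set 'I_n}) (s : 'I_n) : nat := #|[set t in S | (t < s)%N]|.

(* The partial map [phi_B]: the sides of [B = S * T] are its two projections. *)
Definition block_coord (B : {set cell n}) (x : cell n) : option ('I_k * 'I_k) :=
  if x \in B then
    [pick u : 'I_k * 'I_k |
      (u.1 == rank_in [set y.1 | y in B] x.1 :> nat) &&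
      (u.2 == rank_in [set y.2 | y in B] x.2 :> nat)]
  else None.

End placements.

Section placement_facts.
Local Open Scope set_scope.

Lemma card_ltn n i : (i <= n)%N -> #|[set s : 'I_n | (s < i)%N]| = i.
Proof.
move=> le.
have -> : [set s : 'I_n | (s < i)%N] = [set widen_ord le x | x : 'I_i].
  apply/setP => s; rewrite inE; apply/idP/imsetP => [h|[x _ ->]]; last exact: (ltn_ord x).
  by exists (Ordinal h) => //; apply/val_inj.
by rewrite card_imset ?card_ord// => x y /(congr1 val) /= /val_inj.
Qed.

Lemma card_between n a b : (a <= b)%N -> (b <= n)%N ->
  #|[set s : 'I_n | (a <= s < b)%N]| = (b - a)%N.
Proof.
move=> ab bn.
have := cardsID [set s : 'I_n | (s < a)%N] [set s : 'I_n | (s < b)%N].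
rewrite (card_ltn bn).
have -> : [set s : 'I_n | (s < b)%N] :&: [set s : 'I_n | (s < a)%N] =
  [set s : 'I_n | (s < a)%N] by apply/setP => s; rewrite !inE; lia.
have -> : [set s : 'I_n | (s < b)%N] :\: [set s : 'I_n | (s < a)%N] =
  [set s : 'I_n | (a <= s < b)%N] by apply/setP => s; rewrite !inE; lia.
rewrite card_ltn; lia.
Qed.

Lemma coord_setX k n i j (x : cell n) (u v : 'I_k) :
  (i + k <= n)%N -> (j + k <= n)%N ->
  x.1 = (i + u)%N :> nat -> x.2 = (j + v)%N :> nat ->
  block_coord k (finset.setX (interval k n i) (interval k n j)) x = Some (u, v).
Proof.
move=> ik jk x1 x2; have hu := ltn_ord u; have hv := ltn_ord v.
have xi : x.1 \in interval k n i by rewrite inE; lia.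
have xj : x.2 \in interval k n j by rewrite inE; lia.
rewrite /block_coord inE xi xj /=.
have -> : [set y.1 | y in finset.setX (interval k n i) (interval k n j)] = interval k n i.
  apply/setP => s; apply/imsetP/idP => [[y + ->]|si]; first by rewrite inE => /andP[].
  by exists (s, x.2) => //; rewrite inE si xj.
have -> : [set y.2 | y in finset.setX (interval k n i) (interval k n j)] = interval k n j.
  apply/setP => s; apply/imsetP/idP => [[y + ->]|si]; first by rewrite inE => /andP[].
  by exists (x.1, s) => //; rewrite inE si xi.
have r m0 (s : 'I_n) (w : 'I_k) : (m0 + k <= n)%N -> s = (m0 + w)%N :> nat ->
    rank_in (interval k n m0) s = w.
  move=> h e; rewrite /rank_in.
  have hw := ltn_ord w.
  rewrite -[RHS](_ : (m0 + w) - m0 = w)%N; last lia.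
  rewrite -(@card_between n m0 (m0 + w)); [|lia|lia].
  by apply: eq_card => t; rewrite !inE; lia.
rewrite (r i _ u)// (r j _ v)//.
case: pickP => [[a b]/= /andP[/eqP/val_inj -> /eqP/val_inj ->]//|/(_ (u, v))/=].
by rewrite !eqxx.
Qed.

Lemma con_placements_gt0 k m n : (0 < k)%N -> (m * k <= n)%N ->
  (0 < #|con_placements k m n|)%N.
Proof.
move=> k0 mk; apply/card_gt0P.
pose I (l : 'I_m) := finset.setX (interval k n (l * k)) (interval k n (l * k)).
have lk (l : 'I_m) : (l * k + k <= n)%N by have := ltn_ord l; nia.
have hk (l : 'I_m) : (l * k < n)%N by have := lk l; lia.
have Ie l : (Ordinal (hk l), Ordinal (hk l)) \in I l by rewrite !inE /=; lia.
have dis (l l' : 'I_m) x : x \in I l -> x \in I l' -> l = l'.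
  rewrite !inE => h h'; apply/val_inj => /=. nia.
exists [set I l | l : 'I_m]; rewrite inE; apply/and3P; split.
- apply/fintype.subsetP => _ /imsetP[l _ ->].
  have hi : interval k n (l * k) \in intervals k n.
    have h : (l * k < n.+1)%N by have := hk l; lia.
    by apply/imsetP; exists (Ordinal h) => //; rewrite inE /=.
  by apply/imset2P; exists (interval k n (l * k)) (interval k n (l * k)).
- by rewrite card_imset ?card_ord// => l l' e; apply: (dis _ _ _ (Ie l)); rewrite -e.
- apply/finset.trivIsetP => _ _ /imsetP[l _ ->] /imsetP[l' _ ->] ne.
  rewrite -setI_eq0; apply/eqP/setP => x; rewrite finset.in_setI finset.in_set0.
  apply/negP => /andP[a b]; move: ne; rewrite (dis _ _ _ a b) eqxx//.
Qed.

Lemma bijections_gt0 k m n K : K \in con_placements k m n ->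
  (0 < #|bijections m K|)%N.
Proof.
rewrite inE => /and3P[_ /eqP Km _]; apply/card_gt0P.
have c : #|{: {B | B \in K}}| = m by rewrite card_sig -Km; apply: eq_card => x; rewrite inE.
exists [ffun B => cast_ord c (enum_rank B)]; rewrite inE; apply/andP; split.
  apply/injectiveP => B B'; rewrite !ffunE => /cast_ord_inj. exact: enum_rank_inj.
apply/forallP => l; apply/codomP; exists (enum_val (cast_ord (esym c) l)).
by rewrite ffunE enum_valK cast_ordKV.
Qed.

End placement_facts.

Inductive shift_model := MeanShift | VarianceShift.

Section laws.
Variables (R : realType) (mod : shift_model) (k m n : nat).
Variable theta : 'I_m -> 'M[R]_k.

Local Notation realT := (measurableTypeR R).
Local Notation matT := (n.-tuple (n.-tuple realT)).

(* The second parameter of [normal_prob] is the standard deviation. *)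
Definition std_normal : probability realT R := normal_prob 0 1.

Definition shifted_normal (t : R) : probability realT R :=
  match mod with
  | MeanShift => normal_prob t 1
  | VarianceShift => normal_prob 0 (Num.sqrt (1 + t))
  end.

Definition entry_law (K : {set {set cell n}}) (b : labelling m K)
    (x : cell n) : probability realT R :=
  if [pick Bu : {B : {set cell n} | B \in K} * ('I_k * 'I_k) |
        block_coord k (val Bu.1) x == Some Bu.2] is Some (B, (u, v))
  then shifted_normal (theta (b B) u v) else std_normal.

Definition matrix_law (P : 'I_n -> 'I_n -> probability realT R) :
    probability matT R :=
  prod_prob (fun i => prod_prob (fun j => P i j)).

Definition null_law : probability matT R := matrix_law (fun _ _ => std_normal).

Definition alt_law_given (K : {set {set cell n}}) (b : labelling m K) :
    probability matT R :=
  matrix_law (fun i j => entry_law b (i, j)).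

Definition alt_law : {finite_measure set matT -> \bar R} :=
  uniform_mixture (con_placements k m n) (fun K =>
    uniform_mixture (bijections m K) (fun b => alt_law_given b)).

End laws.

Lemma alt_law_setT (R : realType) mod k m n (theta : 'I_m -> 'M[R]_k) :
  (0 < k)%N -> (m * k <= n)%N -> alt_law mod n theta setT = 1%E.
Proof.
move=> k0 mk; apply: uniform_mixture_setT => [|K KP].
  exact: con_placements_gt0.
apply: uniform_mixture_setT => [|b _]; first exact: bijections_gt0 KP.
exact: probability_setT.
Qed.

Section energies.
Variables (R : realType) (k m : nat).
Variable theta : 'I_m -> 'M[R]_k.

Definition energy (l : 'I_m) : R := \sum_(u < k) \sum_(v < k) theta l u v ^+ 2.

Definition max_energy : R := \big[Num.max/0]_(l < m) energy l.

(* The norm of a matrix is its largest entry in absolute value. *)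
Definition max_norm : R := \big[Num.max/0]_(l < m) `|theta l|.

Definition spikiness : R :=
  \big[Num.max/0]_(l < m) (k%:R ^+ 2 * `|theta l| ^+ 2 / energy l).

End energies.

Definition smooth_regime (R : realType) (m k : nat -> nat)
    (theta : forall n, 'I_(m n) -> 'M[R]_(k n)) : Prop :=
  ((fun n => max_norm (theta n)) =O_\oo (fun=> 1 : R)) /\
  ((fun n => spikiness (theta n)) =O_\oo (fun=> 1 : R)).

(* Main.v *)
(* The second moment method: if [L] is the likelihood ratio of the alternative,
   the total variation distance is at most the square root of [E_0 L^2 - 1], and
   [E_0 L^2] averages, over two independent labelled placements, a product over
   cells of the cross moments [E_0 (L_a L_b)] of the shifted entries, where
   [L_a], [L_b] are the ratios with parameters [a], [b].  Each cross moment is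
   at most [expR (c |a b|)], which is [1] off the overlap of the two placements,
   and non-spikiness bounds [|a b|] by a multiple of [E / k^2] on it.  The
   templates and the labellings thus disappear, leaving an exponential moment
   of the number of overlapping cells.  This number is at most [k^2] times the
   number of blocks of one placement meeting the other one; each of its [m]
   blocks, resampled given the others, meets a fixed placement with probability
   of order [m k^2 / n^2], so the exponential moment is at most
   [(1 + rho expR (c' E)) ^ m] with [m rho = O((m k / n)^2)], which tends to
   [1] as [expR (c' E)] is at most of order [n / (m k)]. *)
Require Import Defs.
From HB Require Import structures.
From mathcomp Require Import all_boot all_order all_algebra.
From mathcomp Require Import all_classical all_reals all_analysis.
From mathcomp Require Import measurable_realfun ring lra zify.

Set Implicit Arguments.
Unset Strict Implicit.
Unset Printing Implicit Defensive.

Import Order.TTheory GRing.Theory Num.Theory.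
Import numFieldNormedType.Exports.

Local Open Scope classical_set_scope.
Local Open Scope ring_scope.

(** * Densities of product measures *)

Section density.
Context d (T : measurableType d) (R : realType).
Local Open Scope ereal_scope.

Import HBNNSimple.

(** By linearity the identity passes from indicators to simple functions. Monotone convergence along
    increasing simple approximations of [g] then extends it, on both sides at once. *)
Lemma integral_density (mu nu : {measure set T -> \bar R}) (f : T -> R) :
  measurable_fun setT f -> (forall x, 0 <= f x)%R ->
  (forall A, measurable A -> nu A = \int[mu]_(x in A) (f x)%:E) ->
  forall g : T -> \bar R, measurable_fun setT g -> (forall x, 0 <= g x) ->
  \int[nu]_x g x = \int[mu]_x (g x * (f x)%:E).
Proof.
move=> mf f0 nuE g mg g0.
pose h := nnsfun_approx measurableT mg.
have hcvg x : (h n x)%:E @[n --> \oo] --> g x.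
  by apply: cvg_nnsfun_approx.
have -> : \int[nu]_x g x = limn (fun n => \int[nu]_x (h n x)%:E).
  rewrite -monotone_convergence//.
  - by apply: eq_integral => x _; apply/esym/cvg_lim.
  - by move=> n; exact/measurable_EFinP.
  - by move=> n x _; rewrite lee_fin.
  - by move=> x _ a b ab; rewrite lee_fin; exact/lefP/nd_nnsfun_approx.
have -> : \int[mu]_x (g x * (f x)%:E) =
    limn (fun n => \int[mu]_x ((h n x)%:E * (f x)%:E)).
  rewrite -monotone_convergence//.
  - apply: eq_integral => x _; apply/esym/cvg_lim => //.
    exact: cvgeZr.
  - by move=> n; apply: emeasurable_funM; exact/measurable_EFinP.
  - by move=> n x _; rewrite mule_ge0 ?lee_fin.
  - move=> x _ a b ab; rewrite lee_wpmul2r ?lee_fin//.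
    exact/lefP/nd_nnsfun_approx.
congr (limn _); apply/funext => n.
rewrite integral_nnsfun//=.
transitivity (\int[mu]_x (\sum_(y \in range (h n))
    (y * \1_(h n @^-1` [set y]) x * f x)%:E)).
  rewrite ge0_integral_fsum//=; last 2 first.
  - move=> r; apply/measurable_EFinP; apply: measurable_funM => //.
    by apply: measurable_funM => //; exact: measurable_indic.
  - move=> r x _; rewrite lee_fin mulr_ge0//.
    (* A negative coefficient [r] is harmless: [h n] never takes that value, so its indicator
       vanishes. *)
    have [r0|r0] := leP 0%R r; first by rewrite mulr_ge0.
    by rewrite preimage_nnfun0// indicE in_set0 mulr0.
  rewrite sintegralE patch_setT; apply: eq_fsbigr => r.
  rewrite inE => -[t _ <-].
  under eq_integral do rewrite -mulrA EFinM.
  rewrite ge0_integralZl//=; last 3 first.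
  - by apply/measurable_EFinP; apply: measurable_funM.
  - by move=> x _; rewrite lee_fin mulr_ge0.
  - by rewrite lee_fin.
  rewrite nuE//; congr (_ * _).
  rewrite integral_mkcond; apply: eq_integral => x _.
  by rewrite epatch_indic/= muleC -EFinM.
apply: eq_integral => x _.
by rewrite [in RHS]fimfunE -EFinM fsumEFin// -mulr_fsuml.
Qed.

(** Densities are tested on nonnegative functions rather than on sets, so that they can be applied
    to one factor at a time under an iterated integral. *)
Definition has_density (mu nu : set T -> \bar R) (f : T -> R) :=
  [/\ measurable_fun setT f, forall x, (0 <= f x)%R &
    forall g : T -> \bar R, measurable_fun setT g -> (forall x, 0 <= g x) ->
      \int[nu]_x g x = \int[mu]_x (g x * (f x)%:E)].

End density.

Section product_density.
Context d (T : measurableType d) (R : realType).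
Local Open Scope ereal_scope.

Lemma integral_prod_probS n (P : 'I_n.+1 -> probability T R)
    (g : n.+1.-tuple T -> \bar R) :
  measurable_fun setT g -> (forall x, 0 <= g x) ->
  \int[prod_prob P]_x g x = \int[P ord0]_a
    \int[prod_prob (fun i => P (lift ord0 i))]_x g (cons_pair (a, x)).
Proof.
move=> mg g0.
rewrite /= /distribution ge0_integral_pushforward//=.
  by rewrite preimage_setT fubini_tonelli1//; exact: measurableT_comp.
Qed.

Lemma measurable_tuple_prod n (f : 'I_n -> T -> R) :
  (forall i, measurable_fun setT (f i)) ->
  measurable_fun setT (fun x : n.-tuple T => \prod_(i < n) f i (tnth x i))%R.
Proof.
move=> mf; apply: measurable_prod => i _.
by apply: measurableT_comp => //; exact: measurable_tnth.
Qed.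

(** Induction on [n]: Tonelli isolates the first coordinate, the first density is applied to the
    partial integral, and the induction hypothesis changes the law of the remaining coordinates
    inside. *)
Lemma has_density_prod_prob n (P Q : 'I_n -> probability T R)
    (f : 'I_n -> T -> R) :
  (forall i, has_density (P i) (Q i) (f i)) ->
  has_density (prod_prob P) (prod_prob Q)
    (fun x => \prod_(i < n) f i (tnth x i))%R.
Proof.
elim: n P Q f => [|n IHn] P Q f PQ.
  split => [|x|g mg g0].
  - by apply: measurable_tuple_prod => -[].
  - by rewrite big_ord0.
  - by apply: eq_integral => x _; rewrite big_ord0 mule1.
have mf i : measurable_fun setT (f i) by case: (PQ i).
have f0 i x : (0 <= f i x)%R by case: (PQ i).
split => [|x|g mg g0]; first exact: measurable_tuple_prod.
  exact: prodr_ge0.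
have [_ _ PQ0] := PQ ord0.
have [mF F0 IH] := IHn _ _ _ (fun i => PQ (lift ord0 i)).
have mcons a : measurable_fun setT (fun x : n.-tuple T => cons_pair (a, x)).
  by apply: (measurableT_comp (measurable_cons_pair (n := n))).
rewrite !integral_prod_probS//; last 2 first.
- apply: emeasurable_funM => //; apply/measurable_EFinP.
  exact: measurable_tuple_prod.
- by move=> x; rewrite mule_ge0// lee_fin prodr_ge0.
rewrite PQ0; last 2 first.
- apply: (@measurable_fun_fubini_tonelli_F _ _ _ _ _ _ (fun z => g (cons_pair z))) => //.
  exact: measurableT_comp.
- by move=> x; exact: integral_ge0.
apply: eq_integral => a _.
rewrite IH//; last by exact: (measurableT_comp mg).
rewrite -ge0_integralZr//; last 3 first.
- apply: emeasurable_funM; first exact: (measurableT_comp mg).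
  exact/measurable_EFinP.
- by move=> x _; rewrite mule_ge0// lee_fin.
- by rewrite lee_fin.
apply: eq_integral => x _.
rewrite -muleA; congr (_ * _).
rewrite -EFinM big_ord_recl mulrC; congr (_ * _)%:E.
by apply: eq_bigr => i _; rewrite tnthS.
Qed.

(** Independence in the form of expectations that multiply; nonnegativity lets Tonelli serve without
    integrability conditions. *)
Lemma integral_tuple_prod n (P : 'I_n -> probability T R)
    (f : 'I_n -> T -> R) (c : 'I_n -> R) :
  (forall i, measurable_fun setT (f i)) -> (forall i x, 0 <= f i x)%R ->
  (forall i, \int[P i]_x (f i x)%:E = (c i)%:E) ->
  \int[prod_prob P]_x (\prod_(i < n) f i (tnth x i))%:E =
    (\prod_(i < n) c i)%:E.
Proof.
elim: n P f c => [|n IHn] P f c mf f0 fE.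
  under eq_integral do rewrite big_ord0.
  by rewrite integral_cst//= diracT mule1 big_ord0.
rewrite integral_prod_probS; last 2 first.
- by apply/measurable_EFinP; exact: measurable_tuple_prod.
- by move=> x; rewrite lee_fin prodr_ge0.
rewrite big_ord_recl EFinM -fE -ge0_integralZr//; last 3 first.
- exact/measurable_EFinP.
- by move=> x _; rewrite lee_fin.
- rewrite lee_fin prodr_ge0// => i _.
  by rewrite -lee_fin -fE integral_ge0// => x _; rewrite lee_fin.
apply: eq_integral => a _.
rewrite -(IHn (fun i => P (lift ord0 i)) (fun i => f (lift ord0 i)))//.
rewrite -ge0_integralZl//; last 3 first.
- apply/measurable_EFinP.
  exact: (@measurable_tuple_prod _ (fun i => f (lift ord0 i))).
- by move=> x _; rewrite lee_fin prodr_ge0.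
- by rewrite lee_fin.
apply: eq_integral => x _.
rewrite -EFinM big_ord_recl; congr (_ * _)%:E.
by apply: eq_bigr => i _; rewrite tnthS.
Qed.

End product_density.

(** * Total variation distance and mixtures *)

Section total_variation_bound.
Context d (T : measurableType d) (R : realType).

Lemma tv_dist_ge0 (P Q : {finite_measure set T -> \bar R}) : 0 <= tv_dist P Q.
Proof.
rewrite /tv_dist; case: cid => A exN; case: cid => B hahn.
by rewrite mulr_ge0 ?invr_ge0// fine_ge0// measure_ge0.
Qed.

(** On a Hahn decomposition [(A, B)] the variation of [P - Q] is [(P A - Q A) + (Q B - P B)]; each
    bracket is at most [e], and the factor one half absorbs the two of them. *)
Lemma tv_dist_le (P Q : {finite_measure set T -> \bar R}) (e : R) :
  (forall A, measurable A -> (P A <= Q A + e%:E)%E /\ (Q A <= P A + e%:E)%E) ->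
  tv_dist P Q <= e.
Proof.
move=> PQ; rewrite /tv_dist; case: cid => A exN; case: cid => B hahn.
rewrite ler_pdivrMl//.
have [[mA Apos] [mB Bneg] _ _] := hahn.
have [PQA _] := PQ _ mA; have [_ QPB] := PQ _ mB.
have PF X : measurable X -> P X = (fine (P X))%:E.
  by move=> mX; rewrite fineK// fin_num_measure.
have QF X : measurable X -> Q X = (fine (Q X))%:E.
  by move=> mX; rewrite fineK// fin_num_measure.
have {PQA QPB} : (P A - Q A + (Q B - P B) <= (2 * e)%:E)%E.
  move: PQA QPB; rewrite (PF _ mA) (PF _ mB) (QF _ mA) (QF _ mB).
  by rewrite -!EFinD !lee_fin; lra.
have -> : charge_variation hahn setT = (P A - Q A + (Q B - P B))%E.
  rewrite /charge_variation/= jordan_posE jordan_negE cjordan_posE cjordan_negE.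
  rewrite /crestr0 mem_set// /crestr !setTI /diff_charge /cadd /copp/=.
  by rewrite fin_num_oppeD ?fin_num_measure// oppeK; congr (_ + _)%E; rewrite addeC.
by rewrite (PF _ mA) (PF _ mB) (QF _ mA) (QF _ mB).
Qed.

(* Integrating [2 e (L - 1) <= e^2 + (L - 1)^2] and its opposite avoids the
   Cauchy-Schwarz inequality. *)
Lemma tv_dist_chi2 (P : probability T R) (Q : {finite_measure set T -> \bar R})
    (L : T -> R) (e : R) :
  0 < e -> measurable_fun setT L -> (forall x, 0 <= L x) -> Q setT = 1%E ->
  (forall A, measurable A -> Q A = \int[P]_(x in A) (L x)%:E)%E ->
  (\int[P]_x (L x * L x)%:E <= (1 + e ^+ 2)%:E)%E ->
  tv_dist P Q <= e.
Proof.
move=> e0 mL L0 QT QE L2.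
pose phi x := (L x - 1) ^+ 2.
have mphi : measurable_fun setT phi.
  by apply: measurable_funX; exact: measurable_funB.
have phi0 x : 0 <= phi x by exact: sqr_ge0.
have I1 A : measurable A -> (\int[P]_(x in A) cst 1%E x = P A)%E.
  by move=> mA; rewrite integral_cst// mul1e.
have intc A (c : R) (g : T -> R) : measurable A -> 0 <= c -> measurable_fun setT g ->
    (forall x, 0 <= g x) ->
    (\int[P]_(x in A) (c * g x)%:E = c%:E * \int[P]_(x in A) (g x)%:E)%E.
  move=> mA c0 mg g0; under eq_integral do rewrite EFinM.
  rewrite ge0_integralZl//; last by move=> x _; rewrite lee_fin.
  by apply/measurable_EFinP; exact: measurable_funTS.
have intD A (g h : T -> R) : measurable A -> measurable_fun setT g ->
    (forall x, 0 <= g x) -> measurable_fun setT h -> (forall x, 0 <= h x) ->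
    (\int[P]_(x in A) (g x + h x)%:E =
     \int[P]_(x in A) (g x)%:E + \int[P]_(x in A) (h x)%:E)%E.
  move=> mA mg g0 mh h0; under eq_integral do rewrite EFinD.
  by rewrite ge0_integralD//; [move=> x _; rewrite lee_fin|
    apply/measurable_EFinP; exact: measurable_funTS|
    move=> x _; rewrite lee_fin|
    apply/measurable_EFinP; exact: measurable_funTS].
(* The identity [(L - 1) ^+ 2 + 2 * L = L ^+ 2 + 1] is integrated in this additive form, where every
   integrand is nonnegative and no infinite quantity is subtracted. *)
have intphi : (\int[P]_x (phi x)%:E <= (e ^+ 2)%:E)%E.
  have : (\int[P]_x (phi x)%:E + 2%:E * Q setT =
      \int[P]_x (L x * L x)%:E + P setT)%E.
    rewrite QE// -intc// -[P setT]I1// -intD//; last 2 first.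
    - by apply: measurable_funM.
    - by move=> x; rewrite mulr_ge0.
    rewrite -intD//; last 2 first.
    - by apply: measurable_funM.
    - by move=> x; rewrite mulr_ge0.
    by apply: eq_integral => x _; congr EFin; rewrite /phi; lra.
  rewrite QT probability_setT mule1.
  move: L2; have : (0 <= \int[P]_x (L x * L x)%:E)%E.
    by apply: integral_ge0 => x _; rewrite lee_fin mulr_ge0.
  have : (0 <= \int[P]_x (phi x)%:E)%E.
    by apply: integral_ge0 => x _; rewrite lee_fin.
  case: (integral _ _ (fun x => (phi x)%:E)) => [a| |]//; last first.
    by case: (integral _ _ _) => [b| |].
  case: (integral _ _ _) => [b| |]//.
  by move=> _ _ + []; rewrite !lee_fin; lra.
have intphiA A : measurable A -> (\int[P]_(x in A) (phi x)%:E <= (e ^+ 2)%:E)%E.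
  move=> mA; apply: le_trans intphi; apply: ge0_subset_integral => //.
  - by apply/measurable_EFinP.
  - by move=> x _; rewrite lee_fin.
have e2 : 0 <= 2 * e by rewrite mulr_ge0// ltW.
(* Applied to the pairs [(L, 1)] and [(1, L)]. The error [2 * e ^+ 2] is [e ^+ 2] from the integral
   of [phi] plus [e ^+ 2] from the constant, as [P A] is at most 1. *)
have int_le A (g h : T -> R) : measurable A -> measurable_fun setT g ->
    (forall x, 0 <= g x) -> measurable_fun setT h -> (forall x, 0 <= h x) ->
    (forall x, 2 * e * g x <= 2 * e * h x + (phi x + e ^+ 2)) ->
    ((2 * e)%:E * \int[P]_(x in A) (g x)%:E <=
    (2 * e)%:E * \int[P]_(x in A) (h x)%:E + (2 * e ^+ 2)%:E)%E.
  move=> mA mg g0 mh h0 gh.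
  have mc c (f : T -> R) : measurable_fun setT f ->
      measurable_fun setT (fun x => c * f x) by move=> ?; exact: measurable_funM.
  have e20 x : 0 <= e ^+ 2 * cst 1 x by rewrite mulr_ge0 ?sqr_ge0.
  have le1 : (\int[P]_(x in A) (2 * e * g x)%:E <=
      \int[P]_(x in A) (2 * e * h x + (phi x + e ^+ 2 * cst 1 x))%:E)%E.
    apply: ge0_le_integral => //.
    - by move=> x _; rewrite lee_fin mulr_ge0.
    - by apply/measurable_EFinP; exact/measurable_funTS/mc.
    - apply/measurable_EFinP; apply: measurable_funTS.
      apply: measurable_funD; first exact: mc.
      by apply: measurable_funD => //; exact: mc.
    - by move=> x _; rewrite lee_fin /= mulr1.
  rewrite -intc//; apply: (le_trans le1).
  rewrite intD//; last 4 first.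
  - exact: mc.
  - by move=> x; rewrite mulr_ge0.
  - by apply: measurable_funD => //; exact: mc.
  - by move=> x; rewrite addr_ge0.
  rewrite intc// leeD2l//.
  rewrite intD//; last exact: mc.
  rewrite intc ?sqr_ge0// I1//.
  rewrite (_ : 2 * e ^+ 2 = e ^+ 2 + e ^+ 2 * 1); last by lra.
  rewrite EFinD leeD ?intphiA// [leRHS]EFinM.
  by rewrite lee_wpmul2l ?lee_fin ?sqr_ge0// probability_le1.
have finP A : measurable A -> P A \is a fin_num by move=> mA; exact: fin_num_measure.
have finQ A : measurable A -> Q A \is a fin_num by move=> mA; exact: fin_num_measure.
have PF A : measurable A -> P A = (fine (P A))%:E by move=> mA; rewrite fineK// finP.
have QF A : measurable A -> Q A = (fine (Q A))%:E by move=> mA; rewrite fineK// finQ.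
apply: tv_dist_le => A mA.
have := int_le A (cst 1) L mA; have := int_le A L (cst 1) mA.
rewrite -!QE// I1// (PF _ mA) (QF _ mA) -!EFinM -!EFinD !lee_fin => h1 h2.
have {}h1 : 2 * e * fine (Q A) <= 2 * e * fine (P A) + 2 * e ^+ 2.
  apply: h1 => // x; have := sqr_ge0 (L x - 1 - e); rewrite /phi !expr2 /=.
  by move=> ?; lra.
have {}h2 : 2 * e * fine (P A) <= 2 * e * fine (Q A) + 2 * e ^+ 2.
  apply: h2 => // x; have := sqr_ge0 (L x - 1 + e); rewrite /phi !expr2 /=.
  by move=> ?; lra.
have e20 : 0 < 2 * e by rewrite mulr_gt0.
have PF' : (P : {finite_measure set T -> \bar R}) A = (fine (P A))%:E by exact: PF.
by rewrite PF' -EFinD !lee_fin; split; rewrite -(ler_pM2l e20); lra.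
Qed.

End total_variation_bound.

Section mixture.
Context d (T : measurableType d) (R : realType) (I : finType) (D : {set I}).

Lemma uniform_mixture_density (P : {measure set T -> \bar R})
    (mu : I -> {finite_measure set T -> \bar R}) (L : I -> T -> R) :
  (forall i, measurable_fun setT (L i)) -> (forall i x, 0 <= L i x) ->
  (forall i A, i \in D -> measurable A ->
    mu i A = \int[P]_(x in A) (L i x)%:E)%E ->
  forall A, measurable A -> uniform_mixture D mu A =
    (\int[P]_(x in A) (#|D|%:R^-1 * \sum_(i in D) L i x)%:E)%E.
Proof.
move=> mL L0 muE A mA; rewrite /uniform_mixture.
under [in RHS]eq_integral do rewrite EFinM -sumEFin -big_enum.
rewrite ge0_integralZl//; last 2 first.
- apply: emeasurable_sum => i; apply/measurable_EFinP; exact: measurable_funTS.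
- by move=> x _; rewrite sume_ge0// => i _; rewrite lee_fin.
congr (_ * _)%E; rewrite ge0_integral_sum//; last 2 first.
- by move=> i; apply/measurable_EFinP; exact: measurable_funTS.
- by move=> i x _; rewrite lee_fin.
by rewrite big_enum; apply: eq_bigr => i iD; rewrite muE.
Qed.

(** Pulls one average out of a second moment, [M] being the other factor. The square of the
    likelihood ratio contains four averages: placement and labelling, each twice. *)
Lemma integral_avgM_le (P : {measure set T -> \bar R}) (L : I -> T -> R)
    (M : T -> R) (c : I -> R) :
  (forall i, measurable_fun setT (L i)) -> (forall i x, 0 <= L i x) ->
  measurable_fun setT M -> (forall x, 0 <= M x) ->
  (forall i, i \in D -> \int[P]_x (L i x * M x)%:E <= (c i)%:E)%E ->
  (\int[P]_x (#|D|%:R^-1 * (\sum_(i in D) L i x) * M x)%:E <=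
    (#|D|%:R^-1 * \sum_(i in D) c i)%:E)%E.
Proof.
move=> mL L0 mM M0 Lc.
have mLM i : measurable_fun setT (fun x => (L i x * M x)%:E).
  by apply/measurable_EFinP; exact: measurable_funM.
under eq_integral do rewrite -mulrA big_distrl/= EFinM -sumEFin -big_enum.
rewrite ge0_integralZl//; last 2 first.
- exact: emeasurable_sum.
- by move=> x _; rewrite sume_ge0// => i _; rewrite lee_fin mulr_ge0.
rewrite EFinM lee_wpmul2l ?lee_fin// -sumEFin ge0_integral_sum//.
  by rewrite big_enum; exact: lee_sum.
by move=> i x _; rewrite lee_fin mulr_ge0.
Qed.

End mixture.

(** * Likelihood ratios of shifted normal laws *)

Section normal_ratio.
Variable R : realType.
Implicit Types a b t v x : R.

Lemma normal_pdf_sqrt v x : 0 < v ->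
  normal_pdf 0 (Num.sqrt v) x =
  (Num.sqrt v)^-1 * (Num.sqrt (pi *+ 2))^-1 * expR (- x ^+ 2 / (v *+ 2)).
Proof.
move=> v0; rewrite normal_pdfE ?gt_eqF ?sqrtr_gt0//.
rewrite /normal_peak /normal_fun sqr_sqrtr ?ltW// subr0.
by rewrite -mulrnAr sqrtrM ?ltW// invfM.
Qed.

Lemma normal_pdf_std x :
  normal_pdf 0 1 x = (Num.sqrt (pi *+ 2))^-1 * expR (- x ^+ 2 / 2).
Proof. by rewrite -{1}(sqrtr1 R) normal_pdf_sqrt// sqrtr1 invr1 mul1r. Qed.

Lemma normal_pdf_unit a x :
  normal_pdf a 1 x = (Num.sqrt (pi *+ 2))^-1 * expR (- (x - a) ^+ 2 / 2).
Proof.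
rewrite normal_pdfE ?oner_eq0// /normal_peak /normal_fun.
by rewrite expr1n mul1r.
Qed.

Lemma normal_pdf_std_gt0 x : 0 < normal_pdf 0 1 x :> R.
Proof.
by rewrite normal_pdf_std mulr_gt0 ?expR_gt0// invr_gt0 sqrtr_gt0 pmulrn_lgt0// pi_gt0.
Qed.

Variable mod : shift_model.

Definition shift_pdf t : R -> R :=
  match mod with
  | MeanShift => normal_pdf t 1
  | VarianceShift => normal_pdf 0 (Num.sqrt (1 + t))
  end.

Definition shift_ratio t x : R := shift_pdf t x / normal_pdf 0 1 x.

Lemma measurable_shift_pdf t : measurable_fun setT (shift_pdf t).
Proof. by rewrite /shift_pdf; case: mod; exact: measurable_normal_pdf. Qed.

Lemma shift_pdf_ge0 t x : 0 <= shift_pdf t x.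
Proof. by rewrite /shift_pdf; case: mod; exact: normal_pdf_ge0. Qed.

Lemma measurable_shift_ratio t : measurable_fun setT (shift_ratio t).
Proof.
apply: measurable_funM; first exact: measurable_shift_pdf.
rewrite (_ : (fun x => _) = (fun x => Num.sqrt (pi *+ 2) * expR (x ^+ 2 / 2))).
  apply: measurable_funM => //; apply: measurableT_comp => //.
  by apply: measurable_funM => //; exact: measurable_funX.
by apply/funext => x; rewrite normal_pdf_std invfM invrK -expRN mulNr opprK.
Qed.

Lemma shift_ratio_ge0 t x : 0 <= shift_ratio t x.
Proof. by rewrite mulr_ge0 ?shift_pdf_ge0// invr_ge0 normal_pdf_ge0. Qed.

Lemma has_density_shifted_normal t :
  has_density (std_normal R) (shifted_normal mod t) (shift_ratio t).
Proof.
split; [exact: measurable_shift_ratio|exact: shift_ratio_ge0|move=> g mg g0].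
rewrite (integral_density (mu := lebesgue_measure) (measurable_shift_pdf t))//;
  last 2 first.
- exact: shift_pdf_ge0.
- by move=> A mA; rewrite /shifted_normal /shift_pdf; case: mod.
rewrite (integral_density (mu := lebesgue_measure) (nu := std_normal R)
  (measurable_normal_pdf 0 1))//; last 3 first.
- exact: normal_pdf_ge0.
- apply: emeasurable_funM => //; apply/measurable_EFinP.
  exact: measurable_shift_ratio.
- by move=> x; rewrite mule_ge0// lee_fin shift_ratio_ge0.
apply: eq_integral => x _; rewrite -muleA -EFinM divfK//.
by rewrite gt_eqF// normal_pdf_std_gt0.
Qed.

End normal_ratio.

(** * Cross moments of Gaussian likelihood ratios *)

Section cross_moment.
Variable R : realType.
Implicit Types a b x : R.

(** Against Lebesgue measure the integrand is the product of the two shifted densities over the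
    standard one. Once this is [h] times a normal density, the integral is [h], so only a pointwise
    identity is left for each model. *)
Lemma integral_cross_ratio mod a b (h m s : R) :
  0 <= h -> (forall x, shift_pdf mod a x * shift_pdf mod b x / normal_pdf 0 1 x =
    h * normal_pdf m s x) ->
  (\int[std_normal R]_x (shift_ratio mod a x * shift_ratio mod b x)%:E = h%:E)%E.
Proof.
move=> h0 E.
rewrite (integral_density (mu := lebesgue_measure) (nu := std_normal R)
  (measurable_normal_pdf 0 1))//; last 3 first.
- exact: normal_pdf_ge0.
- apply/measurable_EFinP.
  by apply: measurable_funM; exact: measurable_shift_ratio.
- by move=> x; rewrite lee_fin mulr_ge0// shift_ratio_ge0.
under eq_integral => x _.
  rewrite -EFinM (_ : _ * _ * _ = h * normal_pdf m s x); first over.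
  rewrite -E /shift_ratio; have := normal_pdf_std_gt0 x; set z := normal_pdf 0 1 x.
  by move=> z0; field; rewrite gt_eqF.
under eq_integral do rewrite EFinM.
rewrite ge0_integralZl//; last 2 first.
- by apply/measurable_EFinP; exact: measurable_normal_pdf.
- by move=> x _; rewrite lee_fin normal_pdf_ge0.
by rewrite integral_normal_pdf mule1.
Qed.

Lemma cross_moment_mean a b :
  (\int[std_normal R]_x (shift_ratio MeanShift a x * shift_ratio MeanShift b x)%:E =
    (expR (a * b))%:E)%E.
Proof.
apply: (integral_cross_ratio (m := a + b) (s := 1)) => [|x]; first exact: expR_ge0.
rewrite /shift_pdf normal_pdf_std !normal_pdf_unit.
set c := (Num.sqrt _)^-1.
have c0 : c != 0 by rewrite invr_neq0// gt_eqF// sqrtr_gt0 pmulrn_lgt0// pi_gt0.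
rewrite [RHS]mulrCA -expRD.
transitivity (c * (expR (- (x - a) ^+ 2 / 2) * expR (- (x - b) ^+ 2 / 2) *
    expR (- (- x ^+ 2 / 2)))).
  by rewrite [in RHS]expRN; field; rewrite c0 gt_eqF// expR_gt0.
by congr (_ * _); rewrite -!expRD; congr expR; field.
Qed.

Lemma cross_moment_variance a b : 0 <= a < 1 -> 0 <= b < 1 ->
  (\int[std_normal R]_x
     (shift_ratio VarianceShift a x * shift_ratio VarianceShift b x)%:E =
    ((Num.sqrt (1 - a * b))^-1)%:E)%E.
Proof.
move=> /andP[a0 a1] /andP[b0 b1].
have ab1 : 0 < 1 - a * b by nra.
have va : 0 < 1 + a by lra.
have vb : 0 < 1 + b by lra.
(* Precisions add up: [v^-1 = (1 + a)^-1 + (1 + b)^-1 - 1], the last term coming from the division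
   by the standard density. *)
pose v := (1 + a) * (1 + b) / (1 - a * b).
have v0 : 0 < v by rewrite divr_gt0// mulr_gt0.
apply: (integral_cross_ratio (m := 0) (s := Num.sqrt v)) => [|x].
  by rewrite invr_ge0.
rewrite /shift_pdf !normal_pdf_sqrt// normal_pdf_std.
set c := (Num.sqrt (pi *+ 2))^-1.
have c0 : c != 0 by rewrite invr_neq0// gt_eqF// sqrtr_gt0 pmulrn_lgt0// pi_gt0.
have -> : (Num.sqrt v)^-1 =
    Num.sqrt (1 - a * b) * ((Num.sqrt (1 + a))^-1 * (Num.sqrt (1 + b))^-1).
  rewrite /v sqrtrM ?mulr_ge0 ?ltW// sqrtrM ?ltW// sqrtrV ?ltW//.
  by rewrite !invfM invrK mulrC.
have sa : Num.sqrt (1 + a) != 0 by rewrite gt_eqF ?sqrtr_gt0.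
have sb : Num.sqrt (1 + b) != 0 by rewrite gt_eqF ?sqrtr_gt0.
have sab : Num.sqrt (1 - a * b) != 0 by rewrite gt_eqF ?sqrtr_gt0.
transitivity ((Num.sqrt (1 + a))^-1 * (Num.sqrt (1 + b))^-1 * c *
    (expR (- x ^+ 2 / ((1 + a) *+ 2)) * expR (- x ^+ 2 / ((1 + b) *+ 2)) *
     expR (- (- x ^+ 2 / 2)))).
  by rewrite [in RHS]expRN; field; rewrite ?c0 ?sa ?sb ?gt_eqF// expR_gt0.
rewrite -!expRD.
transitivity ((Num.sqrt (1 + a))^-1 * (Num.sqrt (1 + b))^-1 * c *
  expR (- x ^+ 2 / (v *+ 2))); last by field; rewrite ?c0 ?sa ?sb ?sab.
congr (_ * expR _); rewrite /v.
by field; rewrite !gt_eqF// mulr_gt0.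
Qed.

(** The square root of [1 - x] is at least [1 - x], and [(1 - x)^-1 = 1 + x / (1 - x)] is at most
    [1 + x / (1 - t)]. *)
Lemma sqrt_inv_le_expR (t x : R) : 0 <= x <= t -> t < 1 ->
  (Num.sqrt (1 - x))^-1 <= expR ((1 - t)^-1 * x).
Proof.
move=> /andP[x0 xt] t1.
have x1 : 0 < 1 - x by lra.
have s1 : Num.sqrt (1 - x) <= 1 by rewrite -[leRHS]sqrtr1 ler_sqrt; lra.
apply: (@le_trans _ _ (1 - x)^-1).
  rewrite lef_pV2 ?posrE ?sqrtr_gt0// -[leLHS](sqr_sqrtr (ltW x1)) expr2.
  by rewrite ler_piMr.
apply: (@le_trans _ _ (1 + (1 - t)^-1 * x)); last exact: expR_ge1Dx.
rewrite (_ : (1 - x)^-1 = 1 + (1 - x)^-1 * x); last by field; rewrite gt_eqF.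
by rewrite lerD2l ler_wpM2r// lef_pV2 ?posrE//; lra.
Qed.

End cross_moment.

(** * Resampling random families of disjoint blocks *)

Section compatible_tuples.
Local Open Scope set_scope.
Variables (R : realType) (T : finType) (Bl : {set T}) (c : rel T) (m : nat).
Hypothesis c_sym : symmetric c.
Implicit Types (f : {ffun 'I_m -> T}) (j : 'I_m) (B : T).

(** Ordered counterpart of a family of [m] blocks: the ordering makes it possible to resample one
    block with the others fixed. *)
Definition compatible_tuples : {set {ffun 'I_m -> T}} :=
  [set f : {ffun 'I_m -> T} | [forall i, f i \in Bl] &&
    [forall i, forall i', (i != i') ==> c (f i) (f i')]].

Definition update f j B : {ffun 'I_m -> T} :=
  [ffun i => if i == j then B else f i].

Definition available f j : {set T} :=
  [set B in Bl | [forall i, (i != j) ==> c (f i) B]].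

Lemma update_id f j : update f j (f j) = f.
Proof. by apply/ffunP => i; rewrite ffunE; case: eqP => // ->. Qed.

Lemma update_update f j B B' : update (update f j B) j B' = update f j B'.
Proof. by apply/ffunP => i; rewrite !ffunE; case: eqP. Qed.

Lemma available_update f j B : available (update f j B) j = available f j.
Proof.
apply/setP => D; rewrite !inE; congr (_ && _); apply: eq_forallb => i.
by rewrite ffunE; case: eqP.
Qed.

Lemma mem_available f j : f \in compatible_tuples -> f j \in available f j.
Proof.
rewrite !inE => /andP[/forallP fB /forallP fc]; rewrite fB; apply/forallP => i.
exact: (forallP (fc i)).
Qed.

Lemma update_compatible f j B : f \in compatible_tuples ->
  B \in available f j -> update f j B \in compatible_tuples.
Proof.
rewrite !inE => /andP[/forallP fB /forallP fc] /andP[BB /forallP Bc].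
apply/andP; split; apply/forallP => i; first by rewrite ffunE; case: ifP.
apply/forallP => i'; apply/implyP => ii'; rewrite !ffunE.
case: (eqVneq i j) ii' => [->|ij] ii'; last first.
  case: (eqVneq i' j) => _; first by have := Bc i; rewrite ij.
  exact: (implyP (forallP (fc i) i')).
case: (eqVneq i' j) ii' => [_ //|i'j _].
by rewrite c_sym; have := Bc i'; rewrite i'j.
Qed.

Variables (w : T -> R) (q : R).
Hypothesis w_ge0 : forall B, 0 <= w B.
Hypothesis q_ge0 : 0 <= q.
Hypothesis w_avg : forall f j, f \in compatible_tuples ->
  \sum_(B in available f j) w B <= q * #|available f j|%:R.

(* Exchanging [f j] with a uniform element of [available f j] preserves the
   uniform law on compatible tuples. *)
Lemma resample_coordinate (phi : {ffun 'I_m -> T} -> R) j :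
  (forall f, 0 <= phi f) -> (forall f B, phi (update f j B) = phi f) ->
  \sum_(f in compatible_tuples) phi f * w (f j) <=
  q * \sum_(f in compatible_tuples) phi f.
Proof.
move=> phi0 phiE.
have a0 f : f \in compatible_tuples -> #|available f j|%:R != 0 :> R.
  move=> fT; rewrite pnatr_eq0 -lt0n; apply/card_gt0P; exists (f j).
  exact: mem_available.
(* Each term is spread evenly over the values available at [j]. Their number depends only on the
   other coordinates, so it is unchanged by the exchange [s] below. *)
have -> : \sum_(f in compatible_tuples) phi f * w (f j) =
    \sum_(f in compatible_tuples) \sum_(B in available f j)
      phi f * w (f j) / #|available f j|%:R.
  apply: eq_bigr => f fT; by rewrite sumr_const -[RHS]mulr_natr divfK// a0.
rewrite pair_big_dep/=.
pose s (p : {ffun 'I_m -> T} * T) := (update p.1 j p.2, p.1 j).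
have sK : involutive s.
  by move=> [f B]; rewrite /s/= update_update update_id ffunE eqxx.
rewrite (reindex_inj (inv_inj sK))/=.
rewrite (eq_bigl (fun p =>
  (p.1 \in compatible_tuples) && (p.2 \in available p.1 j))); last first.
  move=> [f B]/=; rewrite available_update; apply/andP/andP => -[h1 h2].
    rewrite -{1}(update_id f j) -(update_update f j B).
    have h3 : B \in available f j.
      have := mem_available j h1; rewrite available_update.
      by rewrite ffunE eqxx.
    split=> //; apply: update_compatible => //; by rewrite available_update.
  by split; [exact: update_compatible|exact: mem_available].
rewrite (eq_bigr (fun p => phi p.1 * w p.2 / #|available p.1 j|%:R)); last first.
  by move=> [f B] _ /=; rewrite phiE available_update ffunE eqxx.
rewrite -(pair_big_dep (fun f => f \in compatible_tuples)
  (fun f B => B \in available f j)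
  (fun f B => phi f * w B / #|available f j|%:R))/=.
rewrite mulr_sumr; apply: ler_sum => f fT.
rewrite -mulr_suml -mulr_sumr ler_pdivrMr; last first.
  by rewrite lt0r a0//= ler0n.
by rewrite [q * _]mulrC -mulrA ler_wpM2l// w_avg.
Qed.

Lemma sum_compatible_tuples :
  \sum_(f in compatible_tuples) \prod_i w (f i) <=
  q ^+ m * #|compatible_tuples|%:R.
Proof.
(* The weights are removed one coordinate at a time: the product over the coordinates below [t]
   ignores coordinate [t], so resampling the latter costs a factor [q]. *)
suff h t : (t <= m)%N ->
    \sum_(f in compatible_tuples) \prod_(i < m | (i < t)%N) w (f i) <=
    q ^+ t * #|compatible_tuples|%:R.
  apply: le_trans (h m (leqnn m)); apply: ler_sum => f _.
  by under [leRHS]eq_bigl do rewrite ltn_ord.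
elim: t => [|t IH] tm.
  rewrite (eq_bigr (fun=> 1)) ?sumr_const ?mul1r// => f _.
  by rewrite big_pred0.
pose j := Ordinal tm.
rewrite (eq_bigr (fun f : {ffun 'I_m -> T} =>
  (\prod_(i < m | (i < t)%N) w (f i)) * w (f j))); last first.
  move=> f _; rewrite (bigD1 j)//= mulrC; congr (_ * _).
  apply: eq_bigl => i; rewrite ltnS.
  by rewrite -val_eqE /= andbC ltn_neqAle.
apply: (le_trans (resample_coordinate _ _)) => [f|f B|].
- by apply: prodr_ge0.
- apply: eq_bigr => i it; rewrite ffunE; case: eqP => // ij.
  by rewrite ij /= ltnn in it.
- by rewrite exprS -mulrA ler_wpM2l// IH// ltnW.
Qed.

End compatible_tuples.

(** * From ordered tuples to unordered disjoint families *)

Section disjoint_families.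
Local Open Scope set_scope.
Variables (R : realType) (X : finType) (Bl : {set {set X}}) (m : nat).
Hypothesis Bl_neq0 : forall B, B \in Bl -> B != finset.set0.

Definition disjoint_families : {set {set {set X}}} :=
  [set K : {set {set X}} | [&& K \subset Bl, #|K| == m & finset.trivIset K]].

Let disj (B D : {set X}) := B :&: D == finset.set0.

Let disj_sym : symmetric disj.
Proof. by move=> B D; rewrite /disj finset.setIC. Qed.

Let Tup := compatible_tuples Bl disj m.

(** A repeated block would be disjoint from itself, hence empty. *)
Lemma compatible_tuples_inj f : f \in Tup -> injective f.
Proof.
rewrite inE => /andP[/forallP fB /forallP fc] i j fij; apply/eqP/negPn/negP => ij.
have := implyP (forallP (fc i) j) ij.
by rewrite fij /disj finset.setIid; apply/negP/Bl_neq0.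
Qed.

Lemma compatible_tuples_image f : f \in Tup -> [set f i | i : 'I_m] \in disjoint_families.
Proof.
move=> fT; have fi := compatible_tuples_inj fT.
move: fT; rewrite !inE => /andP[/forallP fB /forallP fc]; apply/and3P; split.
- by apply/fintype.subsetP => _ /imsetP[i _ ->].
- by rewrite card_imset// card_ord.
- apply/finset.trivIsetP => _ _ /imsetP[i _ ->] /imsetP[j _ ->] ij.
  rewrite -finset.setI_eq0; apply: (implyP (forallP (fc i) j)).
  by apply: contra_neq ij => ->.
Qed.

(** The tuples with image [K] are exactly the injections of the [m] indices into the [m] blocks of
    [K]. *)
Lemma card_compatible_tuples_image K : K \in disjoint_families ->
  #|[set f in Tup | [set f i | i : 'I_m] == K]| = (m`!)%N.
Proof.
rewrite inE => /and3P[KB /eqP Km tK].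
have <- : #|[set f : {ffun 'I_m -> {set X}} in ffun_on (mem K) | injectiveb f]| = (m`!)%N.
  by rewrite card_inj_ffuns_on Km card_ord ffactnn.
apply: eq_card => f; rewrite !inE; apply/idP/idP.
  move=> /andP[fT /eqP fK]; apply/andP; split.
    by apply/ffun_onP => i; rewrite -fK; apply/imsetP; exists i.
  by apply/injectiveP; apply: compatible_tuples_inj; rewrite inE.
move=> /andP[/ffun_onP fK /injectiveP fi]; apply/andP; split.
  apply/andP; split; apply/forallP => i.
    exact: (fintype.subsetP KB).
  apply/forallP => j; apply/implyP => ij.
  by rewrite /disj finset.setI_eq0 (finset.trivIsetP tK)// (inj_eq fi).
rewrite eqEcard card_imset// Km card_ord leqnn andbT.
by apply/fintype.subsetP => _ /imsetP[i _ ->].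
Qed.

Lemma sum_compatible_tuples_image (phi : {set {set X}} -> R) :
  \sum_(f in Tup) phi [set f i | i : 'I_m] =
  (m`!)%:R * \sum_(K in disjoint_families) phi K.
Proof.
rewrite (partition_big (fun f : {ffun 'I_m -> {set X}} => [set f i | i : 'I_m])
  (mem disjoint_families))/=; last first.
  exact: compatible_tuples_image.
rewrite mulr_sumr; apply: eq_bigr => K KP.
rewrite (eq_bigr (fun=> phi K)); last by move=> f /andP[_ /eqP ->].
rewrite sumr_const -[LHS]mulr_natl; congr (_%:R * _).
rewrite -(card_compatible_tuples_image KP).
by apply: eq_card => f; rewrite [in RHS]inE.
Qed.

Variables (w : {set X} -> R) (q : R).
Hypothesis w_ge0 : forall B, 0 <= w B.
Hypothesis q_ge0 : 0 <= q.

(** Ordering the families multiplies both sides by the same [m!], so the bound for tuples carries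
    over. *)
Lemma sum_disjoint_families :
  (forall f j, f \in Tup -> \sum_(B in available Bl disj f j) w B <=
    q * #|available Bl disj f j|%:R) ->
  \sum_(K in disjoint_families) \prod_(B in K) w B <=
  q ^+ m * #|disjoint_families|%:R.
Proof.
move=> w_avg.
have m0 : 0 < (m`!)%:R :> R by rewrite ltr0n fact_gt0.
rewrite -(ler_pM2l m0) -sum_compatible_tuples_image mulrCA.
have -> : (m`!)%:R * #|disjoint_families|%:R = #|Tup|%:R :> R.
  have := sum_compatible_tuples_image (fun=> 1).
  by rewrite !sumr_const => ->.
apply: le_trans (sum_compatible_tuples disj_sym w_ge0 q_ge0 w_avg).
apply: ler_sum => f fT; rewrite big_imset//=.
by move=> i j _ _; apply: compatible_tuples_inj.
Qed.

End disjoint_families.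

(** * Exponential moment of the overlap with a fixed family *)

Section overlap.
Local Open Scope set_scope.

Lemma card_bigcup_leq (I X : finType) (P : {pred I}) (F : I -> {set X}) :
  (#|\bigcup_(i in P) F i| <= \sum_(i in P) #|F i|)%N.
Proof.
elim/big_ind2: _ => [|a A b B Aa Bb|//]; first by rewrite cards0.
exact: leq_trans (finset.leq_card_setU A B).1 (leq_add Aa Bb).
Qed.

Variables (R : realType) (X : finType) (Bl : {set {set X}}) (m a d : nat).
Hypothesis Bl_neq0 : forall B, B \in Bl -> B != finset.set0.
Hypothesis Bl_size : forall B, B \in Bl -> (#|B| <= a)%N.
Hypothesis Bl_meet : forall B, B \in Bl ->
  (#|[set D in Bl | B :&: D != finset.set0]| <= d)%N.
Hypothesis Bl_many : (m * d < #|Bl|)%N.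

Lemma card_meet_cover K : K \in disjoint_families Bl m ->
  (#|[set D in Bl | finset.cover K :&: D != finset.set0]| <= m * d)%N.
Proof.
rewrite inE => /and3P[KB /eqP Km _].
have sub : [set D in Bl | finset.cover K :&: D != finset.set0] \subset
    \bigcup_(B in K) [set D in Bl | B :&: D != finset.set0].
  apply/fintype.subsetP => D; rewrite inE => /andP[DB /set0Pn[x]].
  rewrite inE => /andP[/bigcupP[B BK xB] xD].
  apply/bigcupP; exists B => //; rewrite inE DB; apply/set0Pn; exists x.
  by rewrite inE xB.
apply: leq_trans (subset_leq_card sub) _.
apply: leq_trans (card_bigcup_leq _ _) _.
rewrite -Km -sum_nat_const; apply: leq_sum => B BK.
by apply: Bl_meet; exact: (fintype.subsetP KB).
Qed.

Lemma card_available f j :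
  f \in compatible_tuples Bl (fun B D => B :&: D == finset.set0) m ->
  (#|Bl| - m * d <= #|available Bl (fun B D => B :&: D == finset.set0) f j|)%N.
Proof.
rewrite inE => /andP[/forallP fB _]; set A := available _ _ _ _.
have sub : Bl \subset A :|: \bigcup_(i in 'I_m) [set D in Bl | f i :&: D != finset.set0].
  apply/fintype.subsetP => D DB; rewrite inE; apply/orP.
  have [DA|] := boolP (D \in A); first by left.
  rewrite inE DB /= negb_forall => /existsP[i]; rewrite negb_imply => /andP[_ h].
  by right; apply/bigcupP; exists i => //; rewrite inE DB.
rewrite leq_subLR addnC; apply: leq_trans (subset_leq_card sub) _.
apply: leq_trans (finset.leq_card_setU _ _).1 _; rewrite leq_add2l.
apply: leq_trans (card_bigcup_leq _ _) _.
rewrite -[m in leqRHS]card_ord -sum_nat_const; apply: leq_sum => i _.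
exact: Bl_meet.
Qed.

(** The overlap is at most the sum of the overlaps of the single blocks of [K] with [U], so the
    exponential is bounded by a product of weights. A weight is 1 unless its block meets [U], and
    then at most [expR (v * a)]; among the at least [#|Bl| - m * d] available blocks, at most
    [m * d] meet [U]. *)
Lemma sum_expR_overlap (v : R) K' : 0 <= v -> K' \in disjoint_families Bl m ->
  \sum_(K in disjoint_families Bl m)
    expR (v * #|finset.cover K :&: finset.cover K'|%:R) <=
  (1 + (m * d)%:R / (#|Bl| - m * d)%:R * expR (v * a%:R)) ^+ m *
  #|disjoint_families Bl m|%:R.
Proof.
move=> v0 K'P; set U := finset.cover K'; set q := 1 + _.
have q0 : 0 <= q by rewrite addr_ge0// mulr_ge0// ?expR_ge0// divr_ge0.
pose w (B : {set X}) : R := expR (v * #|B :&: U|%:R).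
have w_ge0 B : 0 <= w B by exact: expR_ge0.
apply: le_trans (sum_disjoint_families Bl_neq0 w_ge0 q0 _); last first.
  move=> f j fT; set A := available _ _ _ _.
  have cA : (#|Bl| - m * d <= #|A|)%N by exact: card_available.
  pose H := [set D in Bl | U :&: D != finset.set0].
  have cH : (#|A :&: H| <= m * d)%N.
    by apply: leq_trans (card_meet_cover K'P); exact/subset_leq_card/finset.subsetIr.
  apply: (@le_trans _ _ (\sum_(B in A) (1 + expR (v * a%:R) * (B \in H)%:R))).
    apply: ler_sum => B; rewrite inE => /andP[BB _]; rewrite inE BB /=.
    have [|_] := eqVneq (U :&: B) finset.set0.
      by rewrite finset.setIC /w => ->; rewrite cards0 mulr0 expR0 mulr0 addr0.
    rewrite mulr1 (@le_trans _ _ (expR (v * a%:R)))// ?lerDr// /w ler_expR.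
    rewrite ler_wpM2l// ler_nat; apply: leq_trans (Bl_size BB).
    exact/subset_leq_card/finset.subsetIl.
  rewrite big_split/= sumr_const -mulr_sumr -natr_sum.
  have -> : (\sum_(B in A) (B \in H) = #|A :&: H|)%N.
    rewrite -sum1_card big_mkcond [RHS]big_mkcond; apply: eq_bigr => B _.
    by rewrite finset.in_setI; do 2 case: (B \in _).
  rewrite /q mulrDl mul1r lerD2l mulrAC [leRHS]mulrC ler_wpM2l ?expR_ge0//.
  have N0 : 0 < (#|Bl| - m * d)%:R :> R by rewrite ltr0n subn_gt0.
  rewrite mulrAC ler_pdivlMr// -!natrM ler_nat.
  exact: leq_mul.
apply: ler_sum => K; rewrite inE => /and3P[_ _ tK].
rewrite /w -expR_sum ler_expR -mulr_sumr ler_wpM2l// -natr_sum ler_nat.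
have sub : finset.cover K :&: U \subset \bigcup_(B in K) (B :&: U).
  apply/fintype.subsetP => x; rewrite inE => /andP[/bigcupP[B BK xB] xU].
  by apply/bigcupP; exists B => //; rewrite inE xB.
exact: leq_trans (subset_leq_card sub) (card_bigcup_leq _ _).
Qed.

End overlap.

(** * Counting consecutive blocks *)

Section consecutive_blocks.
Local Open Scope set_scope.
Variables (k n : nat).
Hypothesis k_gt0 : (0 < k)%N.

Lemma card_ord_between p a b :
  (#|[set s : 'I_p | (a <= s < b)%N]| <= b - a)%N.
Proof.
rewrite -(size_iota a (b - a)) cardE -(size_map (@nat_of_ord p)); apply: uniq_leq_size.
  by rewrite map_inj_uniq ?enum_uniq//; exact: ord_inj.
by move=> _ /mapP[s + ->]; rewrite mem_enum inE mem_iota; lia.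
Qed.

Lemma interval_inj i j : (i + k <= n)%N -> (j + k <= n)%N ->
  Defs.interval k n i = Defs.interval k n j -> i = j.
Proof.
move=> ik jk /setP e.
have hi : (i < n)%N by lia.
have hj : (j < n)%N by lia.
have := e (Ordinal hi); have := e (Ordinal hj); rewrite !inE /=; lia.
Qed.

Lemma card_interval i : (i + k <= n)%N -> #|Defs.interval k n i| = k.
Proof. by move=> ik; rewrite card_between; lia. Qed.

Lemma card_intervals : (k <= n)%N -> #|Defs.intervals k n| = (n - k).+1.
Proof.
move=> kn; rewrite card_in_imset.
  rewrite -[RHS](@card_ltn n.+1)//; last lia.
  by apply: eq_card => i; rewrite !inE; lia.
move=> i j; rewrite !inE => ik jk /(interval_inj ik jk) e.
exact: val_inj.
Qed.

Lemma con_blocksP B : B \in con_blocks k n -> exists i j,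
  [/\ (i + k <= n)%N, (j + k <= n)%N &
    B = finset.setX (Defs.interval k n i) (Defs.interval k n j)].
Proof.
move=> /imset2P[_ _ /imsetP[i + ->] /imsetP[j + ->] ->]; rewrite !inE => ik jk.
by exists i, j.
Qed.

Lemma mem_con_block i j (i1 : 'I_n) (j1 : 'I_n) :
  ((i1, j1) \in finset.setX (Defs.interval k n i) (Defs.interval k n j)) =
  ((i <= i1 < i + k) && (j <= j1 < j + k))%N.
Proof. by rewrite !inE. Qed.

Lemma con_block_neq0 B : B \in con_blocks k n -> B != finset.set0.
Proof.
move=> /con_blocksP[i [j [ik jk ->]]].
have hi : (i < n)%N by lia.
have hj : (j < n)%N by lia.
apply/set0Pn; exists (Ordinal hi, Ordinal hj); rewrite mem_con_block /=; lia.
Qed.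

Lemma card_con_block B : B \in con_blocks k n -> #|B| = (k ^ 2)%N.
Proof.
by move=> /con_blocksP[i [j [ik jk ->]]]; rewrite cardsX !card_interval// mulnn.
Qed.

Lemma card_con_blocks : (k <= n)%N -> #|con_blocks k n| = ((n - k).+1 ^ 2)%N.
Proof.
move=> kn; rewrite -(card_intervals kn) -mulnn /con_blocks curry_imset2X card_in_imset.
  by rewrite cardsX.
move=> [S T] [S' T']; rewrite !finset.in_setX /=.
move=> /andP[/imsetP[i ik ->] /imsetP[j jk ->]].
move=> /andP[/imsetP[i' ik' ->] /imsetP[j' jk' ->]] /setP e.
move: ik jk ik' jk'; rewrite !inE => ik jk ik' jk'.
have hi : (i < n)%N by lia.
have hj : (j < n)%N by lia.
have hi' : (i' < n)%N by lia.
have hj' : (j' < n)%N by lia.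
have := e (Ordinal hi, Ordinal hj); have := e (Ordinal hi', Ordinal hj').
rewrite !mem_con_block /= => h1 h2.
have -> : i = i' by apply/val_inj => /=; lia.
by have -> : j = j' by apply/val_inj => /=; lia.
Qed.

Lemma card_meet_con_block B : B \in con_blocks k n ->
  (#|[set D in con_blocks k n | B :&: D != finset.set0]| <= (2 * k) ^ 2)%N.
Proof.
move=> /con_blocksP[i [j [ik jk ->]]].
(* Starting points of intervals of length [k] meeting the one that starts at [a]: the offset is less
   than [k] either way, with truncation at 0. There are at most [2 * k - 1] of them, rounded up to
   [2 * k]. *)
pose J a := [set s : 'I_n.+1 | (a + 1 - k <= s < a + k)%N].
pose blk (p : 'I_n.+1 * 'I_n.+1) :=
  finset.setX (Defs.interval k n p.1) (Defs.interval k n p.2).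
have sub : [set D in con_blocks k n |
    finset.setX (Defs.interval k n i) (Defs.interval k n j) :&: D != finset.set0] \subset
    [set blk p | p in finset.setX (J i) (J j)].
  apply/fintype.subsetP => D; rewrite inE.
  move=> /andP[/imset2P[_ _ /imsetP[i' _ ->] /imsetP[j' _ ->] ->]] /set0Pn[[x y]]; rewrite inE !mem_con_block => /andP[h1 h2].
  apply/imsetP; exists (i', j') => //; rewrite !inE /=; lia.
apply: leq_trans (subset_leq_card sub) _.
apply: leq_trans (leq_imset_card _ _) _; rewrite cardsX -mulnn.
by apply: leq_mul; apply: leq_trans (card_ord_between _ _ _) _; lia.
Qed.

Lemma sum_expR_placements (R : realType) (v : R) m K' : 0 <= v -> (k <= n)%N ->
  (m * (2 * k) ^ 2 < (n - k).+1 ^ 2)%N -> K' \in con_placements k m n ->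
  \sum_(K in con_placements k m n)
    expR (v * #|finset.cover K :&: finset.cover K'|%:R) <=
  (1 + (m * (2 * k) ^ 2)%:R / ((n - k).+1 ^ 2 - m * (2 * k) ^ 2)%:R *
    expR (v * (k ^ 2)%:R)) ^+ m * #|con_placements k m n|%:R.
Proof.
move=> v0 kn mk K'P; rewrite -card_con_blocks//.
apply: sum_expR_overlap => //.
- exact: con_block_neq0.
- by move=> B BB; rewrite card_con_block.
- exact: card_meet_con_block.
- by rewrite card_con_blocks.
Qed.

End consecutive_blocks.

(** * Second moment of the likelihood ratio *)

Section cross_moment_bound.
Variable R : realType.

(** One bound for both models: the mean-shift moment [expR (a * b)] fits as [(1 - t)^-1] is at least
    1, and the variance-shift moment fits as [a * b] stays in [[0, t]]. *)
Lemma cross_moment_le mod (t a b : R) : 0 <= t < 1 ->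
  (mod = VarianceShift -> 0 <= a <= t) -> (mod = VarianceShift -> 0 <= b <= t) ->
  exists h : R, [/\ 0 <= h, h <= expR ((1 - t)^-1 * `|a * b|) &
    (\int[std_normal R]_x (shift_ratio mod a x * shift_ratio mod b x)%:E = h%:E)%E].
Proof.
move=> /andP[t0 t1]; case: mod => [_ _|/(_ erefl)/andP[a0 at0] /(_ erefl)/andP[b0 bt]].
  exists (expR (a * b)); split; [exact: expR_ge0| |exact: cross_moment_mean].
  rewrite ler_expR (le_trans (ler_norm _))// ler_peMl// invf_ge1; lra.
exists (Num.sqrt (1 - a * b))^-1; split; first by rewrite invr_ge0.
  rewrite ger0_norm ?mulr_ge0//; apply: sqrt_inv_le_expR => //.
  by rewrite mulr_ge0//=; nra.
by apply: cross_moment_variance; apply/andP; split=> //; lra.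
Qed.

End cross_moment_bound.

Section alternative_ratio.
Variables (R : realType) (mod : shift_model) (k m n : nat).
Variable theta : 'I_m -> 'M[R]_k.

Local Notation realT := (measurableTypeR R).
Local Notation matT := (n.-tuple (n.-tuple realT)).

(** The default 0 turns the background law into a shifted law with null parameter, so all cells can
    be treated alike. *)
Definition cell_shift (K : {set {set cell n}}) (b : labelling m K)
    (x : cell n) : R :=
  if [pick Bu : {B : {set cell n} | B \in K} * ('I_k * 'I_k) |
        block_coord k (val Bu.1) x == Some Bu.2] is Some (B, (u, v))
  then theta (b B) u v else 0.

Lemma shifted_normal0 : shifted_normal mod (0 : R) = std_normal R.
Proof. by rewrite /shifted_normal; case: mod => //; rewrite addr0 sqrtr1. Qed.

Lemma entry_lawE (K : {set {set cell n}}) (b : labelling m K) x :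
  entry_law mod theta b x = shifted_normal mod (cell_shift b x).
Proof.
rewrite /entry_law /cell_shift; case: pickP => [[B [u v]]//|_].
by rewrite shifted_normal0.
Qed.

Lemma cell_shift_notin (K : {set {set cell n}}) (b : labelling m K) x :
  x \notin finset.cover K -> cell_shift b x = 0.
Proof.
rewrite /cell_shift; case: pickP => [[B [u v]]/= + xK|//].
rewrite /block_coord ifF//; apply/negP => xB.
by move/negP: xK; apply; apply/bigcupP; exists (val B) => //; exact: (valP B).
Qed.

Lemma cell_shift_ind (Q : R -> Prop) (K : {set {set cell n}})
    (b : labelling m K) x :
  Q 0 -> (forall l u v, Q (theta l u v)) -> Q (cell_shift b x).
Proof. by rewrite /cell_shift; case: pickP => [[B [u v]]|]. Qed.

Definition alt_ratio (K : {set {set cell n}}) (b : labelling m K) (X : matT) : R :=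
  \prod_(i < n) \prod_(j < n)
    shift_ratio mod (cell_shift b (i, j)) (tnth (tnth X i) j).

Lemma has_density_alt_law_given (K : {set {set cell n}}) (b : labelling m K) :
  has_density (null_law R n) (alt_law_given mod theta b) (alt_ratio b).
Proof.
rewrite /null_law /alt_law_given /matrix_law.
apply: (@has_density_prod_prob _ (n.-tuple realT) R n _ _
  (fun i (Y : n.-tuple realT) =>
    \prod_(j < n) shift_ratio mod (cell_shift b (i, j)) (tnth Y j))) => i.
apply: (@has_density_prod_prob _ realT R n _ _
  (fun j => shift_ratio mod (cell_shift b (i, j)))) => j.
by rewrite entry_lawE; exact: has_density_shifted_normal.
Qed.

Lemma measurable_alt_ratio (K : {set {set cell n}}) (b : labelling m K) :
  measurable_fun setT (alt_ratio b).
Proof. by have [] := has_density_alt_law_given b. Qed.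

Lemma alt_ratio_ge0 (K : {set {set cell n}}) (b : labelling m K) X :
  0 <= alt_ratio b X.
Proof. by have [] := has_density_alt_law_given b. Qed.

Variables (t V : R).
Hypothesis t01 : 0 <= t < 1.
Hypothesis theta_dom : mod = VarianceShift -> forall l u v, 0 <= theta l u v <= t.
Hypothesis theta_sqr : forall l u v, theta l u v ^+ 2 <= V.

Let c := (1 - t)^-1.

(** The integral factors over the cells. Off the overlap one of the two shifts is 0 and the factor
    is at most 1; on the overlap it is at most [expR (c * V)]. *)
Lemma integral_alt_ratioM (K K' : {set {set cell n}})
    (b : labelling m K) (b' : labelling m K') : 0 <= V ->
  (\int[null_law R n]_X (alt_ratio b X * alt_ratio b' X)%:E <=
   (expR (c * V * #|(finset.cover K :&: finset.cover K')%SET|%:R))%:E)%E.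
Proof.
move=> V0.
have c0 : 0 <= c by rewrite invr_ge0; case/andP: t01 => ? ?; lra.
have sq (K0 : {set {set cell n}}) (b0 : labelling m K0) x : cell_shift b0 x ^+ 2 <= V.
  by apply: (cell_shift_ind (Q := fun z => z ^+ 2 <= V)) => //; rewrite expr0n.
have dom (K0 : {set {set cell n}}) (b0 : labelling m K0) x :
    mod = VarianceShift -> 0 <= cell_shift b0 x <= t.
  move=> e; apply: (cell_shift_ind (Q := fun z => 0 <= z <= t)).
    by rewrite lexx/=; case/andP: t01.
  exact: theta_dom.
have /choice[h hP] : forall x : cell n, exists h : R,
    [/\ 0 <= h, h <= expR (c * `|cell_shift b x * cell_shift b' x|) &
    (\int[std_normal R]_y (shift_ratio mod (cell_shift b x) y *
       shift_ratio mod (cell_shift b' x) y)%:E = h%:E)%E].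
  by move=> x; apply: cross_moment_le => //; exact: dom.
have -> : (\int[null_law R n]_X (alt_ratio b X * alt_ratio b' X)%:E =
    (\prod_(i < n) \prod_(j < n) h (i, j))%:E)%E.
  under eq_integral => X _.
    rewrite /alt_ratio -big_split/=.
    under eq_bigr do rewrite -big_split/=.
    over.
  rewrite /null_law /matrix_law.
  apply: (@integral_tuple_prod _ (n.-tuple realT) R n _
    (fun i (Y : n.-tuple realT) => \prod_(j < n)
      (shift_ratio mod (cell_shift b (i, j)) (tnth Y j) *
       shift_ratio mod (cell_shift b' (i, j)) (tnth Y j)))) => [i|i Y|i].
  - apply: (@measurable_tuple_prod _ realT R n (fun j y =>
      (shift_ratio mod (cell_shift b (i, j)) y *
       shift_ratio mod (cell_shift b' (i, j)) y))) => j.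
    by apply: measurable_funM; exact: measurable_shift_ratio.
  - by apply: prodr_ge0 => j _; rewrite mulr_ge0// shift_ratio_ge0.
  - apply: (@integral_tuple_prod _ realT R n _ (fun j y =>
      (shift_ratio mod (cell_shift b (i, j)) y *
       shift_ratio mod (cell_shift b' (i, j)) y))) => [j|j y|j].
    + by apply: measurable_funM; exact: measurable_shift_ratio.
    + by rewrite mulr_ge0// shift_ratio_ge0.
    + by have [] := hP (i, j).
rewrite lee_fin pair_big/= (eq_bigr h); last by case.
apply: (@le_trans _ _ (\prod_(x : cell n)
    expR (c * V * (x \in (finset.cover K :&: finset.cover K')%SET)%:R))).
  apply: ler_prod => x _; have [-> hle _] := hP x; rewrite (le_trans hle)//.
  rewrite ler_expR -mulrA ler_wpM2l// finset.in_setI.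
  have [xK|xK] := boolP (x \in finset.cover K); last first.
    by rewrite cell_shift_notin// mul0r normr0 mulr0.
  have [xK'|xK'] := boolP (x \in finset.cover K'); last first.
    by rewrite [X in _ * X]cell_shift_notin// mulr0 normr0 mulr0.
  rewrite mulr1 normrM.
  have := sq _ b x; rewrite -(real_normK (num_real (cell_shift b x))).
  have := sq _ b' x; rewrite -(real_normK (num_real (cell_shift b' x))).
  (* The product of the two absolute values is at most the mean of their squares, hence at most
     [V]. *)
  have := sqr_ge0 (`|cell_shift b x| - `|cell_shift b' x|).
  by rewrite !expr2 => ? ? ?; lra.
rewrite -expR_sum -mulr_sumr -natr_sum
  (_ : (\sum_ _ _)%N = #|(finset.cover K :&: finset.cover K')%SET|)//.
by rewrite -sum1_card [RHS]big_mkcond.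
Qed.

End alternative_ratio.

(** * Total variation bound at fixed [n] *)

Section alt_law_bound.
Variables (R : realType) (mod : shift_model) (k m n : nat).
Variable theta : 'I_m -> 'M[R]_k.

(** An inequality rather than an equality, since the average over an empty [D] is 0. *)
Lemma avg_const_le (I : finType) (D : {set I}) (C : R) : 0 <= C ->
  #|D|%:R^-1 * \sum_(i in D) C <= C.
Proof.
move=> C0; rewrite sumr_const -[C *+ _]mulr_natl mulrA.
rewrite ler_piMl//; have [->|D0] := eqVneq (#|D|%:R : R) 0; first by rewrite mulr0.
by rewrite mulVf.
Qed.

Variables (t V e : R).
Hypothesis t01 : 0 <= t < 1.
Hypothesis theta_dom : mod = VarianceShift -> forall l u v, 0 <= theta l u v <= t.
Hypothesis theta_sqr : forall l u v, theta l u v ^+ 2 <= V.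
Hypothesis V_ge0 : 0 <= V.
Hypothesis e_gt0 : 0 < e.
Hypothesis k_gt0 : (0 < k)%N.
Hypothesis mk_le : (m * k <= n)%N.
Hypothesis k_le : (k <= n)%N.
Hypothesis m_small : (m * (2 * k) ^ 2 < (n - k).+1 ^ 2)%N.

Lemma tv_dist_alt_law :
  (1 + (m * (2 * k) ^ 2)%:R / ((n - k).+1 ^ 2 - m * (2 * k) ^ 2)%:R *
    expR ((1 - t)^-1 * V * (k ^ 2)%:R)) ^+ m <= 1 + e ^+ 2 ->
  tv_dist (null_law R n) (alt_law mod n theta) <= e.
Proof.
set C := _ ^+ m => Ce.
have C0 : 0 <= C.
  by rewrite exprn_ge0// addr_ge0// mulr_ge0 ?expR_ge0// divr_ge0.
pose inner (K : {set {set cell n}}) X :=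
  #|bijections m K|%:R^-1 * \sum_(b in bijections m K) alt_ratio mod theta b X.
pose L X := #|con_placements k m n|%:R^-1 *
  \sum_(K in con_placements k m n) inner K X.
have mratio (K : {set {set cell n}}) (b : labelling m K) :
    measurable_fun setT (alt_ratio mod theta b).
  exact: measurable_alt_ratio.
have ratio0 (K : {set {set cell n}}) (b : labelling m K) X : 0 <= alt_ratio mod theta b X.
  exact: alt_ratio_ge0.
have minner K : measurable_fun setT (inner K).
  apply: measurable_funM => //.
  rewrite (_ : (fun x => _) =
    (fun x => \sum_(b <- enum (bijections m K)) alt_ratio mod theta b x)).
    exact: measurable_sum.
  by apply/funext => X; rewrite big_enum.
have inner0 K X : 0 <= inner K X by rewrite mulr_ge0// sumr_ge0.
have mL : measurable_fun setT L.
  apply: measurable_funM => //.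
  rewrite (_ : (fun x => _) =
    (fun x => \sum_(K <- enum (con_placements k m n)) inner K x)).
    exact: measurable_sum.
  by apply/funext => X; rewrite big_enum.
have L0 X : 0 <= L X by rewrite mulr_ge0// sumr_ge0.
apply: (tv_dist_chi2 e_gt0 mL L0) => [|A mA|].
- exact: alt_law_setT.
- apply: uniform_mixture_density => //= K B KP mB.
  apply: uniform_mixture_density => //= b D bK mD.
  have [_ _ /(_ (fun X => (\1_D X)%:E))] := has_density_alt_law_given mod theta b.
  rewrite integral_indic// setIT => ->; last 2 first.
  + by apply/measurable_EFinP; exact: measurable_indic.
  + by move=> X; rewrite lee_fin.
  rewrite [in RHS]integral_mkcond; apply: eq_integral => X _.
  by rewrite epatch_indic/= muleC.
(* The first copy of [L] is averaged with the constant bound [C], which reduces the claim to a fixed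
   [K] and [b]. The second copy is then averaged over its labellings, on which the bound [ov] does
   not depend, and finally over its placements. *)
- apply: (@le_trans _ _ C%:E); last by rewrite lee_fin.
  apply: (le_trans (integral_avgM_le (c := fun=> C) _ _ _ _ _)) => //; last first.
    by rewrite lee_fin avg_const_le.
  move=> K KP.
  apply: (le_trans (integral_avgM_le (c := fun=> C) _ _ _ _ _)) => //; last first.
    by rewrite lee_fin avg_const_le.
  move=> b bK.
  under eq_integral do rewrite mulrC.
  pose v := (1 - t)^-1 * V.
  pose ov (K' : {set {set cell n}}) :=
    expR (v * #|(finset.cover K' :&: finset.cover K)%SET|%:R).
  apply: (le_trans (integral_avgM_le (c := ov) _ _ _ _ _)) => //.
    move=> K' K'P.
    apply: (le_trans (integral_avgM_le (c := fun=> ov K') _ _ _ _ _)) => //.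
      by move=> b' _; exact: integral_alt_ratioM.
    by rewrite lee_fin avg_const_le// expR_ge0.
  have P0 : 0 < #|con_placements k m n|%:R :> R.
    by rewrite ltr0n con_placements_gt0.
  rewrite lee_fin ler_pdivrMl// mulrC; apply: sum_expR_placements => //.
  by rewrite mulr_ge0// invr_ge0; case/andP: t01 => _ ?; lra.
Qed.

End alt_law_bound.

(** * Numerical estimates for the overlap moment *)

Section asymptotic_bound.
Variable R : realType.

Lemma expR_le1D2x (x : R) : 0 <= x <= 2^-1 -> expR x <= 1 + 2 * x.
Proof.
move=> /andP[x0 x1]; have x2 : 0 < 1 - x by lra.
apply: (@le_trans _ _ (1 - x)^-1).
  rewrite -[leLHS]invrK lef_pV2 ?posrE ?invr_gt0 ?expR_gt0//.
  by rewrite -expRN; exact: expR_ge1Dx.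
by rewrite -div1r ler_pdivrMr//; nra.
Qed.

(** In units of [n ^ 2], the square of [n - k + 1] is at least 49/64 and the subtracted term at most
    4/64, leaving more than one half. *)
Lemma placement_gap (m k n : nat) : (0 < m)%N -> (0 < k)%N ->
  (8 * (m * k) <= n)%N ->
  (n ^ 2 <= 2 * ((n - k).+1 ^ 2 - m * (2 * k) ^ 2))%N.
Proof.
move=> m0 k0 mkn.
have kmk : (k <= m * k)%N by rewrite leq_pmull.
have h1 : (m * (2 * k) ^ 2 <= 4 * (m * k) ^ 2)%N by rewrite !expnMn; nia.
have h2 : (64 * (m * k) ^ 2 <= n ^ 2)%N.
  by rewrite -[64%N]/(8 ^ 2)%N -expnMn leq_exp2r.
have h3 : (7 * n <= 8 * (n - k).+1)%N by lia.
have h4 : (49 * n ^ 2 <= 64 * (n - k).+1 ^ 2)%N.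
  by rewrite -[64%N]/(8 ^ 2)%N -[49%N]/(7 ^ 2)%N -!expnMn leq_exp2r.
lia.
Qed.

(* With [d = m k / n], the number of blocks meeting a placement is at most
   [8 d ^ 2 / m] times the number of admissible blocks, while the weight
   [expR x] is at most [2 / d]. *)
Lemma overlap_moment_le (m k n : nat) (x d : R) :
  (0 < m)%N -> (0 < k)%N -> (8 * (m * k) <= n)%N -> d = (m * k)%:R / n%:R ->
  32 * d <= 1 ->
  x <= 2^-1 * ln (1 + n%:R ^+ 2 / (k%:R ^+ 2 * m%:R ^+ 2)) ->
  (1 + (m * (2 * k) ^ 2)%:R / ((n - k).+1 ^ 2 - m * (2 * k) ^ 2)%:R *
    expR x) ^+ m <= 1 + 32 * d.
Proof.
move=> m0 k0 mkn dE d32 xle.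
have mk0 : (0 < m * k)%N by rewrite muln_gt0 m0.
have n0 : (0 < n)%N by lia.
have nR : 0 < n%:R :> R by rewrite ltr0n.
have mR : 0 < m%:R :> R by rewrite ltr0n.
have kR : 0 < k%:R :> R by rewrite ltr0n.
have d0 : 0 < d by rewrite dE divr_gt0// ltr0n.
have gap := placement_gap m0 k0 mkn.
set N := (_ - _)%N in gap *.
have n20 : (0 < n ^ 2)%N by rewrite expn_gt0 n0.
have N0 : (0 < N)%N by lia.
have NR : 0 < N%:R :> R by rewrite ltr0n.
have rho : (m * (2 * k) ^ 2)%:R / N%:R <= 8 * d ^+ 2 / m%:R :> R.
  rewrite ler_pdivrMr// mulrAC ler_pdivlMr// dE.
  rewrite expr_div_n mulrA mulrAC ler_pdivlMr ?exprn_gt0//.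
  rewrite -!natrX -!natrM ler_nat.
  rewrite (_ : m * (2 * k) ^ 2 * m = 4 * (m * k) ^ 2)%N; last first.
    by rewrite !expnMn -!mulnn; lia.
  have := leq_mul (leqnn (4 * (m * k) ^ 2)) gap.
  move: ((m * k) ^ 2)%N (n ^ 2)%N => a b; lia.
(* The factor [2^-1] before the logarithm becomes a square root: [expR x] squared is at most
   [1 + d^-2], which is below [4 / d ^+ 2] since [d] is at most 1. *)
have sq : expR x <= 2 / d.
  apply: (le_trans (_ : _ <= expR (2^-1 * ln (1 + n%:R ^+ 2 / (k%:R ^+ 2 * m%:R ^+ 2))))).
    by rewrite ler_expR.
  have -> : n%:R ^+ 2 / (k%:R ^+ 2 * m%:R ^+ 2) = (d^-1) ^+ 2 :> R.
    by rewrite dE natrM; field; rewrite !gt_eqF.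
  set z := 1 + _.
  have z0 : 0 < z by rewrite ltr_wpDr ?sqr_ge0.
  rewrite -(ler_pXn2r (n := 2))// ?nnegrE ?expR_ge0 ?divr_ge0 ?(ltW d0)//.
  rewrite expr2 -expRD -mulrDl (_ : 2^-1 + 2^-1 = 1); last by field.
  rewrite mul1r lnK ?posrE// /z exprMn.
  have d1 : 1 <= d^-1 by rewrite invf_ge1//; lra.
  have : 1 <= d^-1 ^+ 2 by rewrite exprn_ege1.
  lra.
set y := _ / _ * expR x.
have y0 : 0 <= y by rewrite mulr_ge0 ?expR_ge0// divr_ge0.
have my : m%:R * y <= 16 * d.
  apply: (@le_trans _ _ (m%:R * (8 * d ^+ 2 / m%:R * (2 / d)))).
    rewrite ler_wpM2l// /y ler_pM ?expR_ge0// divr_ge0//.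
  rewrite le_eqVlt; apply/orP; left; apply/eqP; field.
  by rewrite !gt_eqF.
(* Since [1 + y <= expR y], the power is at most [expR (m * y)]; its exponent is at most [16 * d],
   hence at most one half, where [expR] has a linear bound. *)
apply: (@le_trans _ _ (expR (m%:R * y))).
  rewrite expRM_natl lerXn2r ?nnegrE ?expR_ge0 ?addr_ge0//.
  exact: expR_ge1Dx.
apply: (@le_trans _ _ (1 + 2 * (m%:R * y))); last by lra.
by apply: expR_le1D2x; rewrite mulr_ge0//=; lra.
Qed.

End asymptotic_bound.

(** * Asymptotics *)

Section energy_bound.
Variables (R : realType) (m k : nat) (theta : 'I_m -> 'M[R]_k).

Lemma energy_ge0 l : 0 <= energy theta l.
Proof. by rewrite sumr_ge0// => u _; rewrite sumr_ge0// => v _; exact: sqr_ge0. Qed.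

Lemma sqr_le_energy l u v : theta l u v ^+ 2 <= energy theta l.
Proof.
rewrite /energy (bigD1 u)//= (bigD1 v)//= -addrA lerDl.
by rewrite addr_ge0// ?sumr_ge0// => i _; rewrite ?sumr_ge0// => *; exact: sqr_ge0.
Qed.

Lemma normr_entry_le l u v : `|theta l u v| <= `|theta l|.
Proof. by rewrite [leRHS]mx_normrE; exact: (le_bigmax _ _ (u, v)). Qed.

(** Non-spikiness spreads the energy evenly: no squared entry exceeds [S] times the average
    [energy theta l / k ^ 2]. *)
Lemma sqr_entry_le (S : R) l u v : 0 <= S -> (0 < k)%N -> spikiness theta <= S ->
  theta l u v ^+ 2 <= S * max_energy theta / k%:R ^+ 2.
Proof.
move=> S0 k0 spS; have kR : 0 < k%:R ^+ 2 :> R by rewrite exprn_gt0// ltr0n.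
have enE : energy theta l <= max_energy theta by exact: (le_bigmax _ _ l).
rewrite ler_pdivlMr// mulrC.
apply: (@le_trans _ _ (S * energy theta l)); last by rewrite ler_wpM2l.
(* For null energy the quotient in [spikiness] is 0 by convention and carries no information, but
   then every entry of the template vanishes. *)
have := energy_ge0 l; rewrite le_eqVlt => /predU1P[en0|en0].
  by rewrite -en0 mulr0 pmulr_rle0// en0 sqr_le_energy.
apply: (@le_trans _ _ (k%:R ^+ 2 * `|theta l| ^+ 2)).
  rewrite ler_pM2l// -[leLHS](real_normK (num_real _)).
  by rewrite lerXn2r ?nnegrE ?normr_ge0// normr_entry_le.
rewrite -ler_pdivrMr//; apply: le_trans spS.
exact: (le_bigmax _ (fun l => k%:R ^+ 2 * `|theta l| ^+ 2 / energy theta l) l).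
Qed.

End energy_bound.

Theorem corollary7 (R : realType) (mod : shift_model) (m k : nat -> nat)
    (theta : forall n, 'I_(m n) -> 'M[R]_(k n)) :
  (forall n, (0 < n)%N -> [/\ (0 < m n)%N, (0 < k n)%N & (m n * k n <= n)%N]) ->
  (mod = VarianceShift -> exists theta0 : R, 0 <= theta0 < 1 /\
    forall n, (0 < n)%N -> forall l u v, 0 <= theta n l u v <= theta0) ->
  smooth_regime theta ->
  (fun n => max_energy (theta n)) =o_\oo
    (fun n => ln (1 + n%:R ^+ 2 / ((k n)%:R ^+ 2 * (m n)%:R ^+ 2)) : R) ->
  (fun n => (m n * k n)%:R : R) =o_\oo (fun n => n%:R : R) ->
  (fun n => tv_dist (null_law R n) (alt_law mod n (theta n))) =o_\oo
    (fun=> 1 : R).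
Proof.
move=> mkP thetaP [_ /eqO_exP[S S0 spS]] /eqoP Eo /eqoP mko.
have [t [t01 theta_dom]] : exists t : R, 0 <= t < 1 /\ (mod = VarianceShift ->
    forall n, (0 < n)%N -> forall l u v, 0 <= theta n l u v <= t).
  case: mod thetaP => [_|/(_ erefl)[t [t01 ht]]]; last by exists t.
  (* In the mean-shift model no bound [t] is needed, and [t = 0] makes the constant [(1 - t)^-1]
     equal to 1. *)
  by exists 0; split=> //; rewrite lexx ltr01.
apply/eqoP => e e0.
have c0 : 0 < (1 - t)^-1 by rewrite invr_gt0 subr_gt0; case/andP: t01.
(* The constant 32 is that of [overlap_moment_le]: with [d <= d0], its smallness condition holds and
   its error term is at most [e ^+ 2]. *)
pose d0 : R := Num.min (e ^+ 2 / 32) 32^-1.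
have d00 : 0 < d0.
  by rewrite lt_min; apply/andP; split; rewrite ?divr_gt0 ?exprn_gt0 ?invr_gt0 ?ltr0n.
(* This tolerance for the energy makes the exponent [(1 - t)^-1 * V * k ^ 2 = (1 - t)^-1 * S *
   max_energy] at most half the logarithm. *)
have eta0 : 0 < 2^-1 / ((1 - t)^-1 * S) by rewrite divr_gt0// mulr_gt0.
near=> n.
have n0 : (0 < n)%N by near: n; exact: nbhs_infty_gt.
have nR : 0 < n%:R :> R by rewrite ltr0n.
have [m0 k0 mkn] := mkP n n0.
have sp : spikiness (theta n) <= S.
  rewrite (le_trans (ler_norm _))// -[leRHS]mulr1 -[X in _ * X]normr1.
  by near: n.
have En : max_energy (theta n) <= 2^-1 / ((1 - t)^-1 * S) *
    ln (1 + n%:R ^+ 2 / ((k n)%:R ^+ 2 * (m n)%:R ^+ 2)).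
  rewrite (le_trans (ler_norm _))// -[X in _ <= _ * X]ger0_norm; last first.
    by rewrite ln_ge0// lerDl divr_ge0 ?mulr_ge0 ?exprn_ge0.
  by near: n; exact: Eo.
pose d : R := (m n * k n)%:R / n%:R.
have dd0 : d <= d0.
  rewrite ler_pdivrMr// -[leLHS]ger0_norm// -[X in _ <= _ * X]ger0_norm//.
  by near: n; exact: mko.
have d32 : 32 * d <= 1.
  by rewrite mulrC -ler_pdivlMr// div1r (le_trans dd0)// ge_min lexx orbT.
have de : 32 * d <= e ^+ 2.
  by rewrite mulrC -ler_pdivlMr// (le_trans dd0)// ge_min lexx.
have mk8 : (8 * (m n * k n) <= n)%N.
  have : 32 * (m n * k n)%:R <= n%:R :> R.
    by rewrite -[leRHS]mul1r -ler_pdivrMr// -mulrA.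
  rewrite -natrM ler_nat; apply: leq_trans.
  by rewrite leq_mul2r orbT.
have gap := placement_gap m0 k0 mk8.
have n20 : (0 < n ^ 2)%N by rewrite expn_gt0 n0.
have kn : (k n <= n)%N by apply: leq_trans mkn; rewrite leq_pmull.
have E0 : 0 <= max_energy (theta n) by exact: bigmax_ge_id.
have kR : (k n)%:R ^+ 2 != 0 :> R by rewrite expf_neq0// pnatr_eq0 -lt0n.
pose V := S * max_energy (theta n) / (k n)%:R ^+ 2.
rewrite normr1 mulr1 ger0_norm ?tv_dist_ge0//.
apply: (tv_dist_alt_law (t := t) (V := V)) => //.
- by move=> modE; exact: theta_dom.
- by move=> l u v; apply: sqr_entry_le => //; exact: ltW.
- by rewrite divr_ge0// ?mulr_ge0 ?exprn_ge0// ltW.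
- by rewrite -subn_gt0; have := leq_trans n20 gap; rewrite muln_gt0.
apply: (le_trans (overlap_moment_le m0 k0 mk8 erefl d32 _)).
  rewrite /V natrX -mulrA divfK// mulrA mulrC -ler_pdivlMr ?mulr_gt0//.
  by rewrite mulrAC.
by rewrite lerD2l.
Unshelve. all: by end_near.
Qed.
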